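(* Let $N\ge 2$, let $q>0$ be real with $q\neq 1$, and let $\lambda\in\mathbb{C}^\times$. Let $\Lambda_{q,\lambda}(H)=\Lambda_q(V)\otimes_{\tau_\lambda}\Lambda_q(V^* )\cong T(H)/\langle R_H\rangle$ be the twisted quantum exterior algebra of $H=V\oplus V^*$ (see context). The PBW-deformations of $\Lambda_{q,\lambda}(H)$ of quadratic-constant type are as follows. For a linear map $\beta:R_H\to\mathbb{C}$ put $U_\beta=T(H)/\langle x-\beta(x):x\in R_H\rangle$. 1) If $\lambda\neq q^{1-\frac1N}$, there are no non-trivial deformations: if $U_\beta$ is a PBW-deformation of $\Lambda_{q,\lambda}(H)$ then $\beta=0$. 2) If $\lambda=q^{1-\frac1N}$, the non-trivial deformations are parametrized by $c\in\mathbb{C}^\times$: for $\beta\ne 0$, $U_\beta$ is a PBW-deformation of $\Lambda_{q,\lambda}(H)$ if and only if there is $c\in\mathbb{C}^\times$ such that $$\beta(\mathcal{V}_{ij})=0\ (i\ge j),\qquad \beta(\mathcal{W}_{ij})=0\ (i\le j),\qquad \beta(\mathcal{M}_{ij})=\delta_{ij}\,c\ (1\le i,j\le N).$$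
   Context: Braidings. $q^{1/N}$ is the positive $N$-th root; $\theta(n)=1$ for $n>0$ and $\theta(n)=0$ for $n\le 0$. $V$ is the fundamental module $V(\omega_1)$ of $U_q(\mathfrak{sl}_N)$ with basis $v_1,\dots,v_N$, and $V^*$ is its dual with dual basis $w_1,\dots,w_N$; $H=V\oplus V^*$. The braidings are the linear isomorphisms $$\widehat{R}_{V,V}(v_i\otimes v_j)=q^{\delta_{ij}-\frac1N}v_j\otimes v_i+\theta(j-i)q^{-\frac1N}(q-q^{-1})v_i\otimes v_j,$$ $$\widehat{R}_{V^*,V^*}(w_i\otimes w_j)=q^{\delta_{ij}-\frac1N}w_j\otimes w_i+\theta(i-j)q^{-\frac1N}(q-q^{-1})w_i\otimes w_j,$$ $$\widehat{R}_{V^*,V}(w_i\otimes v_j)=q^{\frac1N-\delta_{ij}}v_j\otimes w_i-\delta_{ij}q^{\frac1N}(q-q^{-1})\sum_{k=1}^{i-1}v_k\otimes w_k\in V\otimes V^*.$$ Braided exterior algebras. For $W=V$ or $V^*$, $S_q^2W\subset W\otimes W$ is the span of eigenvectors of $\widehat{R}_{W,W}$ with positive eigenvalues, and $\Lambda_q(W)=T(W)/\langle S_q^2W\rangle$, graded by degree. Twisted tensor product. For unital algebras $A,B$, a twisting map is a linear map $\tau:B\otimes A\to A\otimes B$ with $\tau(b\otimes1)=1\otimes b$, $\tau(1\otimes a)=a\otimes 1$ such that $\mu_\tau=(\mu_A\otimes\mu_B)(\mathrm{id}\otimes\tau\otimes\mathrm{id})$ is an associative multiplication on $A\otimes B$;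 the resulting algebra is $A\otimes_\tau B$. For graded $A,B$, $\tau$ is graded if $\tau(B_j\otimes A_i)\subseteq A_i\otimes B_j$. Here $\tau_\lambda:\Lambda_q(V^* )\otimes\Lambda_q(V)\to\Lambda_q(V)\otimes\Lambda_q(V^* )$ is the unique graded twisting map with $\tau_\lambda(w\otimes v)=-\lambda\widehat{R}_{V^*,V}(w\otimes v)$ for $v\in V,w\in V^*$. Relations. $\Lambda_{q,\lambda}(H)$ is the quadratic algebra $T(H)/\langle R_H\rangle$, where $R_H=\mathrm{im}(\mathrm{id}+\sigma_\lambda)\subset H\otimes H$ and $\sigma_\lambda:H\otimes H\to H\otimes H$ equals $q^{1+\frac1N}\widehat{R}_{V,V}$ on $V\otimes V$, $\lambda^{-1}\widehat{R}_{V^*,V}^{-1}$ on $V\otimes V^*$, $\lambda\widehat{R}_{V^*,V}$ on $V^*\otimes V$, and $q^{1+\frac1N}\widehat{R}_{V^*,V^*}$ on $V^*\otimes V^*$. A basis of $R_H$ is given by $\mathcal{V}_{ij}=(\mathrm{id}+\sigma_\lambda)(v_i\otimes v_j)$ for $i\ge j$, $\mathcal{W}_{ij}=(\mathrm{id}+\sigma_\lambda)(w_i\otimes w_j)$ for $i\le j$, and $\mathcal{M}_{ij}=(\mathrm{id}+\sigma_\lambda)(w_i\otimes v_j)$ for all $i,j$. PBW-deformations. Let $A=T(E)/\langle R\rangle$ with $R\subset E\otimes E$, and for a linear map $\beta:R\to\mathbb{C}$ let $U_\beta=T(E)/\langle x-\beta(x):x\in R\rangle$, filtered by degree. $U_\beta$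 is a PBW-deformation of $A$ (of quadratic-constant type) if the natural surjection $A\to\mathrm{gr}\,U_\beta$ is an isomorphism. It is trivial if $\beta=0$. *)

(* Defs.v *)
From HB Require Import structures.
From mathcomp Require Import all_boot all_order all_algebra.
From mathcomp Require Import boolp classical_sets functions reals exp.
From mathcomp Require Import finmap complex monalg.

Set Implicit Arguments.
Unset Strict Implicit.
Unset Printing Implicit Defensive.

Import Order.TTheory GRing.Theory Num.Theory.

Local Open Scope ring_scope.
Local Open Scope quotient_scope.
Local Open Scope complex_scope.

(******************************************************************************)
(* Quotients of modules by submodules and of (noncommutative, possibly zero)  *)
(* algebras by two-sided ideals, extending the Z-module quotient (lmod_quot I) of  *)
(* ring_quotient.                                                             *)
(******************************************************************************)

HB.mixin Record isMulAbsorbing (A : pzRingType) (S : A -> bool) := {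
  absorbMl : forall a u, u \in S -> a * u \in S;
  absorbMr : forall a u, u \in S -> u * a \in S
}.

#[short(type="ideal2Closed")]
HB.structure Definition Ideal2Closed (K : pzRingType) (A : lalgType K) :=
  {S of GRing.AddClosed A S & GRing.isScaleClosed K A S & isMulAbsorbing A S}.

Section LmodQuotient.
Variables (K : pzRingType) (V : lmodType K) (S : submodClosed V).

Definition submod_pred : {pred V} := fun x => x \in S.

Fact submod_pred_zmod : zmod_closed submod_pred.
Proof.
split=> [|x y xS yS]; first exact: (rpred0 S).
by rewrite -scaleN1r; apply: (rpredD xS); apply: rpredZ yS.
Qed.

HB.instance Definition _ := GRing.isZmodClosed.Build V submod_pred
  submod_pred_zmod.

Definition lmod_quot := Quotient.quot submod_pred.
HB.instance Definition _ := GRing.Zmodule.on lmod_quot.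
HB.instance Definition _ := EqQuotient.on lmod_quot.
HB.instance Definition _ := ZmodQuotient.on lmod_quot.

Lemma lmod_quot_eq (x y : V) :
  (\pi_lmod_quot x == \pi_lmod_quot y) = (x - y \in S).
Proof. exact: esym (Quotient.idealrBE submod_pred x y). Qed.

Definition quot_scale (c : K) := lift_op1 lmod_quot ( *:%R c).

Lemma pi_scale c : {morph \pi_lmod_quot : x / c *: x >-> quot_scale c x}.
Proof.
move=> x; unlock quot_scale; apply/eqP; rewrite lmod_quot_eq -scalerBr.
by rewrite rpredZ // -lmod_quot_eq reprK.
Qed.

Lemma quot_scaleA a b x : quot_scale a (quot_scale b x) = quot_scale (a * b) x.
Proof. by rewrite -[x]reprK -!pi_scale scalerA. Qed.

Lemma quot_scale1 : left_id 1 quot_scale.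
Proof. by move=> x; rewrite -[x]reprK -!pi_scale scale1r. Qed.

Lemma quot_scaleDr : right_distributive quot_scale +%R.
Proof.
move=> c x y; rewrite -[x]reprK -[y]reprK -raddfD -!pi_scale.
by rewrite scalerDr raddfD.
Qed.

Lemma quot_scaleDl x : {morph quot_scale^~ x : a b / a + b}.
Proof. by move=> a b; rewrite -[x]reprK -!pi_scale scalerDl raddfD. Qed.

HB.instance Definition _ := GRing.Zmodule_isLmodule.Build K lmod_quot
  quot_scaleA quot_scale1 quot_scaleDr quot_scaleDl.

Definition qproj (x : V) : lmod_quot := \pi x.

Fact qproj_is_linear : linear qproj.
Proof.
by move=> c x y; rewrite /qproj raddfD; congr (_ + _); apply: pi_scale.
Qed.
HB.instance Definition _ :=
  GRing.isLinear.Build K V lmod_quot *:%R qproj qproj_is_linear.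

Lemma qprojP (x y : V) : qproj x = qproj y <-> x - y \in S.
Proof. by rewrite -lmod_quot_eq; split=> /eqP. Qed.

Lemma qproj_eq0 (x : V) : qproj x = 0 <-> x \in S.
Proof. by rewrite -(raddf0 qproj) qprojP subr0. Qed.

Lemma repr_qproj (u : lmod_quot) : qproj (repr u) = u.
Proof. exact: reprK. Qed.

End LmodQuotient.

Section AlgQuotient.
Variables (K : pzRingType) (A : lalgType K) (I : ideal2Closed A).

Definition quot_one : (lmod_quot I) := \pi 1.
Definition quot_mul := lift_op2 (lmod_quot I) *%R.

Lemma pi_mul : {morph \pi_(lmod_quot I) : x y / x * y >-> quot_mul x y}.
Proof.
have dI (z : A) : z - repr (\pi_(lmod_quot I) z) \in I.
  by rewrite -lmod_quot_eq reprK.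
move=> x y; unlock quot_mul; apply/eqP; rewrite lmod_quot_eq.
rewrite -[x * y](addrNK (x * repr (\pi_(lmod_quot I) y))) -mulrBr -addrA -mulrBl.
by apply: rpredD; [apply: absorbMl; apply: dI | apply: absorbMr; apply: dI].
Qed.

Lemma quot_mulA : associative quot_mul.
Proof.
move=> x y z; rewrite -[x]reprK -[y]reprK -[z]reprK.
by rewrite -!pi_mul mulrA.
Qed.

Lemma quot_mul1 : left_id quot_one quot_mul.
Proof. by move=> x; rewrite -[x]reprK -pi_mul mul1r. Qed.

Lemma quot_mulr1 : right_id quot_one quot_mul.
Proof. by move=> x; rewrite -[x]reprK -pi_mul mulr1. Qed.

Lemma quot_mulDl : left_distributive quot_mul +%R.
Proof.
move=> x y z; rewrite -[x]reprK -[y]reprK -[z]reprK.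
by rewrite -raddfD -!pi_mul mulrDl raddfD.
Qed.

Lemma quot_mulDr : right_distributive quot_mul +%R.
Proof.
move=> x y z; rewrite -[x]reprK -[y]reprK -[z]reprK.
by rewrite -raddfD -!pi_mul mulrDr raddfD.
Qed.

HB.instance Definition _ := GRing.Zmodule_isPzRing.Build (lmod_quot I)
  quot_mulA quot_mul1 quot_mulr1 quot_mulDl quot_mulDr.

Fact qproj_is_monoid_morphism : monoid_morphism (qproj I).
Proof. by split=> // x y; apply: pi_mul. Qed.

Lemma qproj1 : qproj I 1 = 1. Proof. by case: qproj_is_monoid_morphism. Qed.

Lemma qprojM : {morph qproj I : x y / x * y}.
Proof. by case: qproj_is_monoid_morphism. Qed.

End AlgQuotient.

(******************************************************************************)
(* The tensor algebra of E = K^d, with basis e_i, is the free algebra on 'I_d *)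
(* (the monoid algebra of the words). The space E (x) E is 'M[K]_d, where     *)
(* u (x) v is u^T *m v, so that e_i (x) e_j is delta_mx i j.                  *)
(******************************************************************************)

Section TensorAlgebra.
Variables (K : fieldType) (d : nat).

Local Notation tensor_alg := {malg K[{fmonom 'I_d}]}.

Definition tgen (i : 'I_d) : tensor_alg := << fmu i >>.

Definition tens2 (M : 'M[K]_d) : tensor_alg :=
  \sum_(i < d) \sum_(j < d) M i j *: (tgen i * tgen j).

(* As with size for polynomials, tsize x is 1 + the degree, and tsize 0 = 0. *)
Definition tsize (x : tensor_alg) : nat :=
  mmeasure (@fdeg 'I_d) x.

Definition hcomp (n : nat) (x : tensor_alg) : tensor_alg :=
  \sum_(w <- msupp x | fdeg w == n) << x@_w *g w >>.


Lemma hcompE n x w : (hcomp n x)@_w = x@_w *+ (fdeg w == n).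
Proof.
rewrite /hcomp raddf_sum /= big_mkcond /=.
have E v : (if fdeg v == n then << x@_v *g v >>@_w else 0) =
    (x@_v *+ (fdeg v == n)) *+ (v == w).
  by case: (fdeg v == n); rewrite ?mul0rn // mcoeffU.
rewrite (eq_bigr _ (fun v _ => E v)).
have [xw|xw] := boolP (w \in msupp x).
  rewrite (big_fsetD1 w) //= eqxx mulr1n big1_fset ?addr0 //.
  by move=> v; rewrite !inE => /andP[/negPf-> _] _.
rewrite mcoeff_outdom // mul0rn big1_fset // => v vx _.
by case: (v =P w) vx xw => [->->|].
Qed.

Fact hcomp_is_linear n : linear (hcomp n).
Proof.
move=> c x y; apply/malgP=> w; rewrite hcompE mcoeffD mcoeffZ.
rewrite mulrnDl -mulrnAr -!hcompE -mcoeffZ.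
exact: esym (mcoeffD w (c *: hcomp n x) (hcomp n y)).
Qed.
HB.instance Definition _ n :=
  GRing.isLinear.Build K tensor_alg tensor_alg *:%R (hcomp n)
    (hcomp_is_linear n).

Lemma hcomp_id n (x : tensor_alg) : (forall w, fdeg w != n -> x@_w = 0) -> hcomp n x = x.
Proof.
by move=> xn; apply/malgP=> w; rewrite hcompE; case: eqP => // /eqP/xn ->.
Qed.

Lemma hcomp_neq m n (x : tensor_alg) :
  (forall w, fdeg w != m -> x@_w = 0) -> m != n -> hcomp n x = 0.
Proof.
move=> xm mn; apply/malgP=> w; rewrite hcompE mcoeff0.
by case: eqP => // wn; rewrite xm // wn eq_sym.
Qed.

Lemma homogM m n (x y : tensor_alg) : (forall w, fdeg w != m -> x@_w = 0) ->
    (forall w, fdeg w != n -> y@_w = 0) ->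
  forall w, fdeg w != (m + n)%N -> (x * y)@_w = 0.
Proof.
move=> xm yn w wmn; rewrite mcoeffMl big1 // => u _; rewrite big1 // => v _.
case: (@eqP _ (mmul u v) w) => // E; rewrite mulr1n.
have [um|/xm->] := eqVneq (fdeg u) m; last by rewrite mul0r.
have [vn|/yn->] := eqVneq (fdeg v) n; last by rewrite mulr0.
by move: wmn; rewrite -E fdegM um vn eqxx.
Qed.

Lemma homogU (c : K) (u w : {fmonom 'I_d}) :
  fdeg w != fdeg u -> << c *g u >>@_w = 0.
Proof. by rewrite mcoeffU; case: (u =P w) => // ->; rewrite eqxx. Qed.

Lemma hcomp_tens2 M : hcomp 2 (tens2 M) = tens2 M.
Proof.
rewrite /tens2 linear_sum; apply: eq_bigr => i _.
rewrite linear_sum; apply: eq_bigr => j _.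
rewrite linearZ; congr (_ *: _); apply: hcomp_id => w w2.
by apply: (@homogM 1 1) => // v v1; apply: homogU; rewrite fdegU.
Qed.

Lemma mul3E (a t b : tensor_alg) : a * t * b =
  \sum_(u <- msupp a) \sum_(v <- msupp b) << a@_u *g u >> * t * << b@_v *g v >>.
Proof.
have -> : a * t = \sum_(u <- msupp a) << a@_u *g u >> * t.
  by rewrite {1}(monalgE a) mulr_suml.
rewrite mulr_suml; apply: eq_bigr => u _.
by rewrite {1}(monalgE b) mulr_sumr.
Qed.

Lemma tsizeP x n :
  (tsize x <= n)%N <-> forall w, (n <= fdeg w)%N -> x@_w = 0.
Proof.
split=> [xn w nw|H].
  by apply: mcoeff_outdom; apply: mmeasure_mnm_ge; apply: leq_trans xn nw.
rewrite /tsize mmeasureE big_seq_fsetE /=; apply/bigmax_leqP => -[w wx] _ /=.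
by rewrite ltnNge; apply/negP => /H/eqP; rewrite mcoeff_eq0 wx.
Qed.

Definition ideal_gen (G : tensor_alg -> Prop) : {pred tensor_alg} := fun x =>
  `[< exists s : seq (tensor_alg * tensor_alg * tensor_alg),
        (forall t, t \in s -> G t.1.2) /\
        x = \sum_(t <- s) t.1.1 * t.1.2 * t.2 >].

Section IdealGen.
Variable G : tensor_alg -> Prop.

Fact ideal_gen_submod : submod_closed (ideal_gen G).
Proof.
split=> [|c x y /asboolP[s [sG ->]] /asboolP[t [tG ->]]]; apply/asboolP.
  by exists [::]; rewrite big_nil.
exists ([seq (c *: u.1.1, u.1.2, u.2) | u <- s] ++ t); split.
  move=> u; rewrite mem_cat => /orP[/mapP[v vs ->]|]; last exact: tG.
  exact: (sG v).
rewrite big_cat big_map /= scaler_sumr; congr (_ + _).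
by apply: eq_bigr => u _; rewrite !scalerAl.
Qed.
HB.instance Definition _ :=
  GRing.isSubmodClosed.Build K tensor_alg (ideal_gen G) ideal_gen_submod.

Fact ideal_gen_Ml a u : u \in ideal_gen G -> a * u \in ideal_gen G.
Proof.
move=> /asboolP[s [sG ->]]; apply/asboolP.
exists [seq (a * t.1.1, t.1.2, t.2) | t <- s]; split.
  by move=> _ /mapP[t ts ->]; apply: (sG t).
by rewrite big_map mulr_sumr; apply: eq_bigr => t _; rewrite !mulrA.
Qed.

Fact ideal_gen_Mr a u : u \in ideal_gen G -> u * a \in ideal_gen G.
Proof.
move=> /asboolP[s [sG ->]]; apply/asboolP.
exists [seq (t.1.1, t.1.2, t.2 * a) | t <- s]; split.
  by move=> _ /mapP[t ts ->]; apply: (sG t).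
by rewrite big_map mulr_suml; apply: eq_bigr => t _; apply/esym/mulrA.
Qed.
HB.instance Definition _ :=
  isMulAbsorbing.Build tensor_alg (ideal_gen G) ideal_gen_Ml ideal_gen_Mr.

Lemma hcomp_ideal_ind k n x (P : tensor_alg -> Prop) :
    P 0 -> (forall y z, P y -> P z -> P (y + z)) ->
    (forall t, G t -> hcomp k t = t) ->
    (forall a u t b v, G t -> (fdeg u + k + fdeg v = n)%N ->
      P (<< a *g u >> * t * << b *g v >>)) ->
  x \in ideal_gen G -> P (hcomp n x).
Proof.
move=> P0 PD Gk Pt /asboolP[s [sG ->]]; rewrite linear_sum big_seq.
apply: big_ind => // -[[a t] b] /sG /= Gt.
have tk w : fdeg w != k -> t@_w = 0.
  by move=> wk; rewrite -(Gk t Gt) hcompE (negPf wk).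
rewrite mul3E linear_sum /=; apply: big_ind => // u _.
rewrite linear_sum /=; apply: big_ind => // v _.
have zh := homogM (homogM (@homogU a@_u u) tk) (@homogU b@_v v).
have [E|ne] := eqVneq (fdeg u + k + fdeg v)%N n.
  by move: zh; rewrite E => zh; rewrite [hcomp n _](hcomp_id zh); apply: Pt.
by rewrite [hcomp n _](hcomp_neq zh ne).
Qed.

End IdealGen.

(******************************************************************************)
(* The quadratic algebra T(E)/<R> and its quadratic-constant deformations.    *)
(******************************************************************************)

Variable R : {vspace 'M[K]_d}.

Definition quad_rel (t : tensor_alg) : Prop :=
  exists x : subvs_of R, t = tens2 (vsval x).

Local Notation quad_alg := (lmod_quot (ideal_gen quad_rel)).

Variable beta : 'Hom(subvs_of R, K^o).

Definition qc_rel (t : tensor_alg) : Prop :=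
  exists x : subvs_of R, t = tens2 (vsval x) - (beta x : K)%:A.

Local Notation qc_alg := (lmod_quot (ideal_gen qc_rel)).

(* The elements of filtration degree < n. *)
Definition qc_filt (n : nat) : {pred qc_alg} := fun u =>
  `[< exists2 x : tensor_alg, (tsize x <= n)%N & u = qproj (ideal_gen qc_rel) x >].

Fact qc_filt_submod n : submod_closed (qc_filt n).
Proof.
split=> [|c u v /asboolP[x xn ->] /asboolP[y yn ->]]; apply/asboolP.
  by exists 0; rewrite ?raddf0 // /tsize mmeasure0.
exists (c *: x + y); last by rewrite linearP.
apply/tsizeP => w nw; rewrite mcoeffD mcoeffZ.
rewrite ((tsizeP x n).1 xn w nw) ((tsizeP y n).1 yn w nw).
by rewrite mulr0 addr0.
Qed.
HB.instance Definition _ n :=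
  GRing.isSubmodClosed.Build K qc_alg (qc_filt n) (qc_filt_submod n).

(* The direct sum over n of F_n / F_(n-1), for F_(n-1) = qc_filt n: families  *)
(* with finite support whose n-th term is in F_n / F_(n-1), the latter being  *)
(* seen inside the quotient of the whole of qc_alg by F_(n-1).                *)
Definition gr_qc : set (forall n, lmod_quot (qc_filt n)) := [set g |
  (forall n, exists2 u, u \in qc_filt n.+1 & g n = qproj (qc_filt n) u) /\
  exists m, forall n, (m <= n)%N -> g n = 0].

(* The class of x is sent to the family of the classes of the homogeneous     *)
(* components of x; see natural_mapE for the independence from x.             *)
Definition natural_map (a : quad_alg) : forall n, lmod_quot (qc_filt n) :=
  fun n => qproj (qc_filt n) (qproj (ideal_gen qc_rel) (hcomp n (repr a))).

Lemma natural_mapE x n : natural_map (qproj (ideal_gen quad_rel) x) n =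
  qproj (qc_filt n) (qproj (ideal_gen qc_rel) (hcomp n x)).
Proof.
rewrite /natural_map; set y := repr _.
have yx : y - x \in ideal_gen quad_rel by apply/qprojP; apply: repr_qproj.
apply/qprojP; rewrite -!linearB; move: (y - x) yx => {x y}z.
apply: (@hcomp_ideal_ind _ 2 n _
  (fun t => qproj (ideal_gen qc_rel) t \in qc_filt n)).
- by rewrite linear0 rpred0.
- by move=> u v un vn; rewrite linearD; apply: rpredD un vn.
- by move=> t [M ->]; apply: hcomp_tens2.
move=> a u _ b v [M ->] uvn; apply/asboolP.
pose c : K := beta M.
exists (<< a *g u >> * c%:A * << b *g v >>).
  apply/tsizeP => w nw; have c0 (w' : {fmonom 'I_d}) : fdeg w' != 0%N -> c%:A@_w' = 0 :> K.
    by rewrite mcoeffZ mcoeff1 fdeg_eq0 => /negPf->; rewrite mulr0.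
  apply: (homogM (homogM (@homogU a u) c0) (@homogU b v)).
  by rewrite gtn_eqF // (leq_trans _ nw) // -uvn addn0 ltn_add2r addn2.
apply/qprojP; rewrite -mulrBl -mulrBr.
apply: ideal_gen_Mr; apply: ideal_gen_Ml.
apply/asboolP; exists [:: (1, tens2 (vsval M) - c%:A, 1)]; split.
  by move=> t; rewrite inE => /eqP ->; exists M.
by rewrite big_seq1 /= mul1r mulr1.
Qed.

Lemma natural_map_surj :
  set_fun setT gr_qc natural_map /\ set_surj setT gr_qc natural_map.
Proof.
split=> [a _|g [gF [m gm]]].
  split=> [n|].
    exists (qproj (ideal_gen qc_rel) (hcomp n (repr a))) => //.
    apply/asboolP; exists (hcomp n (repr a)) => //; apply/tsizeP => w nw.
    by rewrite hcompE gtn_eqF.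
  exists (tsize (repr a)) => n an; apply/qproj_eq0.
  suff -> : hcomp n (repr a) = 0 by rewrite linear0 rpred0.
  apply/malgP => w; rewrite hcompE mcoeff0.
  have [wn|//] := eqVneq (fdeg w) n.
  by rewrite mulr1n; apply: (tsizeP _ _).1 (leqnn _) _ _; rewrite wn.
have gh n : exists y, hcomp n y = y /\
    g n = qproj (qc_filt n) (qproj (ideal_gen qc_rel) y).
  have [_ /asboolP[x xn ->] ->] := gF n.
  exists (hcomp n x); split.
    by apply: hcomp_id => w wn; rewrite hcompE (negPf wn).
  apply/qprojP; rewrite -linearB; apply/asboolP; exists (x - hcomp n x) => //.
  apply/tsizeP => w nw; rewrite mcoeffB hcompE.
  have [_|wn] := eqVneq (fdeg w) n; first by rewrite mulr1n subrr.
  rewrite mulr0n subr0; apply: (tsizeP _ _).1 xn _ _.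
  by rewrite ltn_neqAle eq_sym wn nw.
have [y yP] := choice gh.
exists (qproj (ideal_gen quad_rel) (\sum_(i < m) y i)) => //.
apply: functional_extensionality_dep => n; rewrite natural_mapE.
have hy i : hcomp n (y i) = if i == n then y n else 0.
  have yi w : fdeg w != i -> (y i)@_w = 0.
    by move=> wi; rewrite -(yP i).1 hcompE (negPf wi).
  have [->|ne] := eqVneq i n; first exact: (yP n).1.
  exact: (hcomp_neq yi ne).
have -> : hcomp n (\sum_(i < m) y i) = \sum_(i < m | i == n :> nat) y n.
  by rewrite linear_sum [RHS]big_mkcond; apply: eq_bigr => i _; apply: hy.
have [nm|mn] := ltnP n m.
  by rewrite (big_pred1 (Ordinal nm)) ?(yP n).2 // => i; rewrite -val_eqE.
rewrite big_pred0 ?linear0 ?gm // => i; apply/negbTE.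
by rewrite neq_ltn (leq_trans (ltn_ord i) mn).
Qed.

(* The natural map is a morphism of graded algebras, hence it is an           *)
(* isomorphism if and only if it is bijective.                                *)
Definition is_PBW_deformation : Prop := set_bij setT gr_qc natural_map.

End TensorAlgebra.

(******************************************************************************)
(* The braidings on H = V (+) V^*. The indices are shifted to start from 0.   *)
(* V has basis v_i and V^* has basis w_i, for i : 'I_N, so that the four      *)
(* spaces V (x) V, V^* (x) V^*, V^* (x) V and V (x) V^* are all 'M_N, and     *)
(* H (x) H is the space of matrices                                           *)
(*   block_mx (V (x) V) (V (x) V^* ) (V^* (x) V) (V^* (x) V^* ).              *)
(******************************************************************************)

Section Braidings.
Variables (R : realType) (N : nat) (q : R) (lam : R[i]).
Local Notation C := R[i].

(* The linear map sending the basis tensor (i, j) to f i j. *)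
Definition tensor_ext (f : 'I_N -> 'I_N -> 'M[C]_N) : 'End('M[C]_N) :=
  linfun (fun M : 'M[C]_N => \sum_(i < N) \sum_(j < N) M i j *: f i j).

Definition qpow (s : R) : C := (q `^ s)%:C.
Definition qdiff : C := (q - q^-1)%:C.

Definition R_VV : 'End('M[C]_N) := tensor_ext (fun i j =>
  qpow ((i == j)%:R - N%:R^-1) *: delta_mx j i +
  ((i < j)%N%:R * qpow (- N%:R^-1) * qdiff) *: delta_mx i j).

Definition R_WW : 'End('M[C]_N) := tensor_ext (fun i j =>
  qpow ((i == j)%:R - N%:R^-1) *: delta_mx j i +
  ((j < i)%N%:R * qpow (- N%:R^-1) * qdiff) *: delta_mx i j).

(* From V^* (x) V to V (x) V^*. *)
Definition R_WV : 'End('M[C]_N) := tensor_ext (fun i j =>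
  qpow (N%:R^-1 - (i == j)%:R) *: delta_mx j i -
  ((i == j)%:R * qpow N%:R^-1 * qdiff) *: \sum_(k < N | (k < i)%N) delta_mx k k).

Definition sigma_fun (M : 'M[C]_(N + N)) : 'M[C]_(N + N) :=
  block_mx (qpow (1 + N%:R^-1) *: R_VV (ulsubmx M))
           (lam *: R_WV (dlsubmx M))
           (lam^-1 *: (R_WV^-1)%VF (ursubmx M))
           (qpow (1 + N%:R^-1) *: R_WW (drsubmx M)).

Definition sigma : 'End('M[C]_(N + N)) := linfun sigma_fun.

Definition R_H : {vspace 'M[C]_(N + N)} := limg (\1 + sigma)%VF.

Definition relation_of (M : 'M[C]_(N + N)) : subvs_of R_H :=
  vsproj R_H ((\1 + sigma)%VF M).

(* The elements V_ij, W_ij and M_ij of R_H. *)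
Definition relV (i j : 'I_N) := relation_of (block_mx (delta_mx i j) 0 0 0).
Definition relW (i j : 'I_N) := relation_of (block_mx 0 0 0 (delta_mx i j)).
Definition relM (i j : 'I_N) := relation_of (block_mx 0 0 (delta_mx i j) 0).

Definition clifford_values (beta : 'Hom(subvs_of R_H, C^o)) (c : C) : Prop :=
  [/\ forall i j : 'I_N, (j <= i)%N -> beta (relV i j) = 0,
      forall i j : 'I_N, (i <= j)%N -> beta (relW i j) = 0 &
      forall i j : 'I_N, beta (relM i j) = (i == j)%:R * c].

End Braidings.

(* Main.v *)
From HB Require Import structures.
Require Import Defs.
From mathcomp Require Import all_boot all_order all_algebra.
From mathcomp Require Import boolp classical_sets functions reals exp.
From mathcomp Require Import finmap complex monalg ring.

(* Write mu = lam q^(1/N).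

   If U_beta is a PBW-deformation, then the v_i and w_i are linearly
   independent in it. Evaluating w_i v_j v_j (for j = i and for j <> i),
   w_i v_i v_j, and the words obtained by the anti-automorphism exchanging v_i
   and w_i, in two ways therefore gives linear equations for the values of beta.
   They leave only beta(M_ii) = c, with c = 0 unless mu = q, that is, unless
   lam = q^(1-1/N).

   Conversely, let mu = q and c <> 0. The words in which the v_i come first and
   the indices increase span the quadratic algebra in each degree, so it
   suffices that they are linearly independent in U_beta. They are, because
   they act independently on the quantum Fock space, the exterior algebra of V
   with basis indexed by the subsets of {1..N}, on which v_i acts by creation
   and w_i by annihilation. *)

Set Implicit Arguments.
Unset Strict Implicit.
Unset Printing Implicit Defensive.

Import Order.TTheory GRing.Theory Num.Theory.

Local Open Scope ring_scope.
Local Open Scope complex_scope.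

(** * Action of the tensor algebra *)

(** Write a_ij and m_ij for the constants attached to v_i v_j and w_i v_j. The two evaluations of
    w_i v_i v_i have the same cubic part, so their difference is linear in the generators. Its
    coefficients are m_ii (1 - mu/q), a_ii (1 - (mu/q)^2) and nonzero multiples of m_ki and a_ik for
    k < i. The word w_k v_i v_i with k <> i adds a_ii (1 - mu^2) = 0. As q^2 <> 1, the numbers mu^2
    and (mu/q)^2 are not both 1, hence a_ii = 0. The word w_i v_i v_j with i = j + 1 gives m_ii =
    m_jj when mu = q.

    In the converse the obstacle is the tail of M_ii, a multiple of the sum of v_k w_k over k < i.
    Annihilation is given the same power of -q as creation. Then v_k w_k is diagonal on the Fock
    space, with value c q^(2r) on a subset that contains k and has r elements below k, and 0 on the
    other subsets. With the coefficient q^2 - 1, which the tail has when mu = q, these values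
    telescope, and M_ii acts as the scalar c. *)

Lemma qprojB (K : pzRingType) (V : lmodType K) (S : submodClosed V) (x y : V) :
  qproj S (x - y) = qproj S x - qproj S y.
Proof. exact: raddfB. Qed.

Lemma qprojD (K : pzRingType) (V : lmodType K) (S : submodClosed V) (x y : V) :
  qproj S (x + y) = qproj S x + qproj S y.
Proof. exact: raddfD. Qed.

Section Words.
Variables (K : fieldType) (d : nat).

Local Notation tensor_alg := {malg K[{fmonom 'I_d}]}.
Implicit Types (x y z : tensor_alg) (u v w : {fmonom 'I_d}).

Lemma malgMUU (a b : K) u v :
  << a *g u >> * << b *g v >> = << a * b *g mmul u v >> :> tensor_alg.
Proof. by rewrite malgM_def fgmulUU. Qed.

Lemma tgenM i j : tgen K i * tgen K j = << FMonom [:: i; j] >> :> tensor_alg.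
Proof.
rewrite malgMUU mulr1; congr (<< _ *g _ >>).
by apply/eqP; rewrite fmP fmM !fmU.
Qed.

Lemma malgZU (a b : K) w : a *: << b *g w >> = << a * b *g w >> :> tensor_alg.
Proof. by apply/malgP => u; rewrite mcoeffZ !mcoeffU mulrnAr. Qed.

Lemma malgZAr (a : K) x y : a *: (x * y) = x * (a *: y).
Proof.
rewrite (monalgE x) (monalgE y) !mulr_suml !scaler_sumr.
apply: eq_bigr => u _; rewrite !mulr_sumr scaler_sumr.
by apply: eq_bigr => v _; rewrite malgMUU !malgZU malgMUU mulrCA.
Qed.

Lemma tens2_is_linear : linear (@tens2 K d).
Proof.
move=> c M P; rewrite /tens2 scaler_sumr -big_split /=; apply: eq_bigr => i _.
rewrite scaler_sumr -big_split /=; apply: eq_bigr => j _.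
by rewrite !mxE scalerDl scalerA.
Qed.
HB.instance Definition _ := GRing.isLinear.Build K 'M[K]_d tensor_alg *:%R
  (@tens2 K d) tens2_is_linear.

Lemma tens2B M P : tens2 (M - P) = tens2 M - tens2 P :> tensor_alg.
Proof. exact: raddfB. Qed.

Lemma tens2D M P : tens2 (M + P) = tens2 M + tens2 P :> tensor_alg.
Proof. exact: raddfD. Qed.

Lemma tens2Z c M : tens2 (c *: M) = c *: tens2 M :> tensor_alg.
Proof. exact: linearZ. Qed.

Lemma tens2_delta i j : tens2 (delta_mx i j) = tgen K i * tgen K j :> tensor_alg.
Proof.
rewrite /tens2 (bigD1 i) //= [X in _ + X]big1 ?addr0; last first.
  by move=> k /negPf ki; rewrite big1 // => l _; rewrite mxE ki scale0r.
rewrite (bigD1 j) //= [X in _ + X]big1 ?addr0; last first.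
  by move=> l /negPf lj; rewrite mxE lj andbF scale0r.
by rewrite mxE !eqxx scale1r.
Qed.

Section Action.
Variables (F : lmodType K) (g : 'I_d -> {linear F -> F}).

Definition word_act (s : seq 'I_d) (f : F) : F := foldr (fun i => g i) f s.

(** The module structure over the free algebra in which the generator [i] acts by [g i]. The last
    letter of a word acts first, which makes this a left action. *)
Definition tens_act (f : F) x : F := \sum_(w <- msupp x) x@_w *: word_act w f.

Lemma tens_actEw (f : F) x (D : {fset {fmonom 'I_d}}) : (msupp x `<=` D)%fset ->
  tens_act f x = \sum_(w <- D) x@_w *: word_act w f.
Proof.
move=> le; rewrite [LHS](big_fset_incl _ le) => //= w wD /mcoeff_outdom ->.
by rewrite scale0r.
Qed.

Lemma tens_act_is_linear f : linear (tens_act f).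
Proof.
move=> c x y; pose D := (msupp x `|` msupp y)%fset.
have xD : (msupp x `<=` D)%fset by apply: fsubsetUl.
have yD : (msupp y `<=` D)%fset by apply: fsubsetUr.
have xyD : (msupp (c *: x + y) `<=` D)%fset.
  apply: fsubset_trans (msuppD_le _ _) _.
  by rewrite fsubUset yD (fsubset_trans (msuppZ_le _ _) xD).
rewrite (tens_actEw f xD) (tens_actEw f yD) (tens_actEw f xyD).
rewrite scaler_sumr -big_split /=; apply: eq_bigr => w _.
by rewrite mcoeffD mcoeffZ scalerDl scalerA.
Qed.
HB.instance Definition _ f := GRing.isLinear.Build K tensor_alg F *:%R
  (tens_act f) (tens_act_is_linear f).

Lemma tens_actZ f c x : tens_act f (c *: x) = c *: tens_act f x.
Proof. exact: linearZ. Qed.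

Lemma tens_actD f x y : tens_act f (x + y) = tens_act f x + tens_act f y.
Proof. exact: raddfD. Qed.

Lemma tens_act_sum f (I : Type) (r : seq I) (P : pred I) (E : I -> tensor_alg) :
  tens_act f (\sum_(i <- r | P i) E i) = \sum_(i <- r | P i) tens_act f (E i).
Proof. exact: raddf_sum. Qed.

Lemma tens_act_lin f c e x y z : tens_act f (x + c *: y - e *: z) =
  tens_act f x + c *: tens_act f y - e *: tens_act f z.
Proof. by rewrite linearB linearD !linearZ. Qed.

Lemma word_act_is_linear s : linear (word_act s).
Proof. by move=> c f h; elim: s => //= i s ->; rewrite linearP. Qed.
HB.instance Definition _ s := GRing.isLinear.Build K F F *:%R
  (word_act s) (word_act_is_linear s).

Lemma tens_actU f a w : tens_act f << a *g w >> = a *: word_act w f.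
Proof. by rewrite (tens_actEw f msuppU_le) big_seq_fset1 mcoeffUU. Qed.

Lemma tens_actM f x y : tens_act f (x * y) = tens_act (tens_act f y) x.
Proof.
rewrite [in LHS](monalgE x) mulr_suml linear_sum; apply: eq_bigr => u _ /=.
rewrite [in LHS](monalgE y) mulr_sumr linear_sum [in RHS]linear_sum scaler_sumr.
apply: eq_bigr => v _ /=; rewrite malgMUU tens_actU fmM /word_act foldr_cat.
by rewrite -!/(word_act _ _) linearZ scalerA.
Qed.

Lemma tens_act1 f : tens_act f 1 = f.
Proof. by rewrite tens_actU scale1r fm1. Qed.

Lemma tens_act_tgen f i : tens_act f (tgen K i) = g i f.
Proof. by rewrite tens_actU scale1r fmU. Qed.

Lemma tens_act0 x : tens_act 0 x = 0.
Proof. by rewrite /tens_act big1 // => w _; rewrite linear0 scaler0. Qed.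

Lemma tens_act_ideal (G : tensor_alg -> Prop) f x :
  (forall t h, G t -> tens_act h t = 0) -> x \in ideal_gen G -> tens_act f x = 0.
Proof.
move=> G0 /asboolP[s [sG ->]]; rewrite linear_sum big_seq big1 // => t ts /=.
by rewrite !tens_actM (G0 _ _ (sG t ts)) tens_act0.
Qed.

End Action.
End Words.

(** * PBW-deformations *)

Section PBW.
Variables (K : fieldType) (d : nat) (R : {vspace 'M[K]_d}).

Local Notation tensor_alg := {malg K[{fmonom 'I_d}]}.
Implicit Types (x y z : tensor_alg) (u v w : {fmonom 'I_d}).

Lemma mem_ideal_gen (G : tensor_alg -> Prop) x : G x -> x \in ideal_gen G.
Proof.
move=> Gx; apply/asboolP; exists [:: (1, x, 1)].
by split=> [t|]; rewrite ?big_seq1 /= ?mul1r ?mulr1 // inE => /eqP ->.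
Qed.

Lemma quad_ideal_tens2 M : M \in R -> tens2 M \in ideal_gen (quad_rel R).
Proof.
by move=> MR; apply: mem_ideal_gen; exists (vsproj R M); rewrite vsprojK.
Qed.

(** * Straightening into strictly increasing words *)

Definition homogeneous n x := forall w, fdeg w != n -> x@_w = 0.

(** The increase is strict because squares of generators are also leading terms of relations. *)
Definition normal_word (s : seq 'I_d) := sorted (fun i j : 'I_d => (i < j)%N) s.

Definition normal_form x := forall w, ~~ normal_word w -> x@_w = 0.

Lemma homogeneous_hcomp n x : homogeneous n (hcomp n x).
Proof. by move=> w wn; rewrite hcompE (negPf wn). Qed.

Lemma homogeneousP n c x y :
  homogeneous n x -> homogeneous n y -> homogeneous n (c *: x + y).
Proof. by move=> xn yn w wn; rewrite mcoeffD mcoeffZ xn ?yn // mulr0 addr0. Qed.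

Lemma normal_formP c x y :
  normal_form x -> normal_form y -> normal_form (c *: x + y).
Proof. by move=> xn yn w wn; rewrite mcoeffD mcoeffZ xn ?yn // mulr0 addr0. Qed.

Lemma unsorted_split (s : seq 'I_d) : ~~ normal_word s ->
  exists s1 a b s2, s = s1 ++ [:: a, b & s2] /\ (b <= a)%N.
Proof.
elim: s => [|a [|b s] IHs] //; rewrite /normal_word /=.
have [ab|ba _] := ltnP a b; last by exists [::], a, b, s.
by move=> /= /IHs [s1 [a' [b' [s2 [-> ?]]]]]; exists (a :: s1), a', b', s2.
Qed.

(* Orders words of a given length lexicographically. *)
Definition word_code (s : seq 'I_d) : nat := foldl (fun n (i : 'I_d) => n * d + i)%N 0%N s.

(** In base [d] the second letter of the pair contributes less than one unit of the first, so
    lowering the first letter lowers the numeral whatever the second becomes. This is why [leading]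
    only constrains first letters. *)
Lemma word_code_ltn (s1 s2 : seq 'I_d) (a b c e : 'I_d) : (c < a)%N ->
  (word_code (s1 ++ [:: c, e & s2]) < word_code (s1 ++ [:: a, b & s2]))%N.
Proof.
move=> ca; rewrite /word_code !foldl_cat /=.
set m := foldl _ _ s1.
have : ((m * d + c) * d + e < (m * d + a) * d + b)%N.
  have ed := ltn_ord e; apply: leq_trans (leq_addr _ _).
  apply: (@leq_trans ((m * d + c).+1 * d)); first by rewrite mulSnr ltn_add2l.
  by rewrite leq_mul2r -addnS leq_add2l ca orbT.
elim: s2 (_ + e)%N (_ + b)%N => //= i s2 IHs n p np; apply: IHs.
have id := ltn_ord i; rewrite ltn_add2r ltn_mul2r np andbT.
exact: leq_ltn_trans id.
Qed.

Lemma monomE (s1 s2 s3 : seq 'I_d) :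
  << FMonom (s1 ++ s2 ++ s3) >> =
  << FMonom s1 >> * << FMonom s2 >> * << FMonom s3 >> :> tensor_alg.
Proof.
by rewrite !malgMUU !mulr1; congr (<< _ *g _ >>); apply/eqP; rewrite fmP !fmM catA.
Qed.

Hypothesis leading : forall a b : 'I_d, (b <= a)%N ->
  exists2 M, delta_mx a b + M \in R & forall c e, M c e != 0 -> (c < a)%N.

(** A word that is not normal contains a pair a, b with b <= a. The relation given by [leading]
    rewrites it into words of the same length and smaller code, so the rewriting terminates and
    preserves the degree. *)
Lemma quad_normal_word w : exists y, [/\ homogeneous (fdeg w) y, normal_form y &
  << w >> - y \in ideal_gen (quad_rel R)].
Proof.
have [n] := ubnP (word_code w); elim: n w => // n IHn w; rewrite ltnS => wn.
have [w_nf|] := boolP (normal_word w).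
  exists << w >>; split; last by rewrite subrr rpred0.
    by move=> u uw; apply: homogU.
  by move=> u; rewrite mcoeffU; case: (w =P u) => // <-; rewrite w_nf.
case/unsorted_split => s1 [a [b [s2 [w_def ba]]]].
have [M MR Mlt] := leading ba.
have Ew : w = FMonom (s1 ++ [:: a; b] ++ s2) by apply/eqP; rewrite fmP w_def.
pose mid (c e : 'I_d) := FMonom (s1 ++ [:: c; e] ++ s2).
have red (c e : 'I_d) : exists y, [/\ homogeneous (fdeg w) y, normal_form y &
    M c e *: << mid c e >> - y \in ideal_gen (quad_rel R)].
  have [ce0|ce] := eqVneq (M c e) 0.
    exists 0; split; try by move=> ?; rewrite mcoeff0.
    by rewrite ce0 scale0r subrr rpred0.
  have [|y [y1 y2 y3]] := IHn (mid c e).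
    by apply: leq_trans wn; rewrite Ew; apply: word_code_ltn; apply: Mlt ce.
  exists (M c e *: y); split.
  - rewrite -[_ *: y]addr0; apply: homogeneousP => [|?]; last by rewrite mcoeff0.
    by move: y1; rewrite Ew /fdeg /= !size_cat.
  - by rewrite -[_ *: y]addr0; apply: normal_formP => // ?; rewrite mcoeff0.
  by rewrite -scalerBr rpredZ.
have /choice[f fP] (c : 'I_d * 'I_d) := red c.1 c.2.
exists (- \sum_c f c); split.
- move=> u uw; rewrite mcoeffN raddf_sum big1 ?oppr0 // => c _.
  by case: (fP c) => /(_ u uw).
- move=> u uw; rewrite mcoeffN raddf_sum big1 ?oppr0 // => c _.
  by case: (fP c) => _ /(_ u uw).
have -> : << w >> - - \sum_c f c =
    << FMonom s1 >> * tens2 (delta_mx a b + M) * << FMonom s2 >>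
    - \sum_c (M c.1 c.2 *: << mid c.1 c.2 >> - f c).
  have E : \sum_c M c.1 c.2 *: << mid c.1 c.2 >> =
      << FMonom s1 >> * tens2 M * << FMonom s2 >>.
    rewrite -(pair_bigA _ (fun c e => M c e *: << mid c e >>)) /=.
    rewrite /tens2 mulr_sumr mulr_suml; apply: eq_bigr => c _.
    rewrite mulr_sumr mulr_suml; apply: eq_bigr => e _.
    by rewrite tgenM -malgZAr -scalerAl -monomE.
  have -> : << FMonom s1 >> * tens2 (delta_mx a b + M) * << FMonom s2 >> =
      << w >> + << FMonom s1 >> * tens2 M * << FMonom s2 >>.
    have Em := monomE s1 [:: a; b] s2; rewrite -Ew -tgenM in Em.
    by rewrite Em tens2D tens2_delta [X in X * _ = _]mulrDr [LHS]mulrDl.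
  rewrite sumrB E opprK.
  move: (\sum_c f c) (_ * _) << w >> => s p t.
  by rewrite opprB addrA addrAC addrK.
apply: rpredB; last by apply: rpred_sum => c _; case: (fP c).
by apply: absorbMr; apply: absorbMl; apply: quad_ideal_tens2.
Qed.

Lemma quad_normal_form n x : homogeneous n x -> exists y,
  [/\ homogeneous n y, normal_form y & x - y \in ideal_gen (quad_rel R)].
Proof.
move=> xn.
have /choice[f fP] w := quad_normal_word w.
exists (\sum_(w <- msupp x) x@_w *: f w); split.
- move=> u un; rewrite raddf_sum big1 // => w _; rewrite /= mcoeffZ.
  have [wn|/xn ->] := eqVneq (fdeg w) n; last by rewrite mul0r.
  by case: (fP w) => -> //; rewrite ?mulr0 // wn.
- move=> u un; rewrite raddf_sum big1 // => w _; rewrite /= mcoeffZ.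
  by case: (fP w) => _ -> //; rewrite mulr0.
rewrite [X in X - _](monalgE x) -sumrB; apply: rpred_sum => w _.
by rewrite -[x@_w]mulr1 -malgZU mulr1 -scalerBr rpredZ //; case: (fP w).
Qed.

(** * Transfer to the deformed algebra *)

Variable beta : 'Hom(subvs_of R, K^o).

Local Notation proj_beta := (qproj (ideal_gen (qc_rel beta))).

(** The top component is straightened in the quadratic algebra. By [natural_mapE] this changes its
    class in the deformed algebra only by something of lower filtration degree, to which the
    induction applies. *)
Lemma qc_normal_form n x : (Defs.tsize x <= n)%N -> exists y,
  [/\ (Defs.tsize y <= n)%N, normal_form y & proj_beta x = proj_beta y].
Proof.
elim: n x => [|n IHn] x xn.
  exists x; split=> // w _; exact: (tsizeP x 0).1.
have [y [y1 y2 /qprojP y3]] := quad_normal_form (@homogeneous_hcomp n x).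
have := natural_mapE beta (hcomp n x) n.
rewrite y3 natural_mapE hcomp_id // hcomp_id; last exact: homogeneous_hcomp.
move/qprojP => /asboolP[z zn Ez].
have [|y' [y1' y2' y3']] := IHn ((x - hcomp n x) - z).
  apply/tsizeP => w nw; rewrite !mcoeffB ((tsizeP z n).1 zn) // subr0 hcompE.
  have [_|wn] := eqVneq (fdeg w) n; first by rewrite subrr.
  by rewrite subr0; apply: (tsizeP x n.+1).1 => //; rewrite ltn_neqAle eq_sym wn.
exists (1 *: y + y'); split.
- apply/tsizeP => w nw; rewrite mcoeffD mcoeffZ y1 ?gtn_eqF // mulr0 add0r.
  by apply: (tsizeP y' n).1 => //; apply: ltnW.
- exact: normal_formP.
rewrite scale1r qprojD -y3' !qprojB.
have cancel (U : zmodType) (a b c e : U) : a - b = e -> c = a + (c - b - e).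
  by move=> <-; rewrite opprB subrKA addrC subrK.
exact: cancel.
Qed.

(** Only injectivity is at stake. Let [t] be the normal form of a homogeneous component of degree n
    whose image in the graded algebra is 0. In the deformed algebra [t] equals an element of degree
    below n, which has a normal form [s] of degree below n. Then [t - s] is a normal form acting by
    0, hence [t = s], and comparing degrees gives [t = 0]. *)
Lemma pbw_of_faithful_action (F : lmodType K) (g : 'I_d -> {linear F -> F}) :
    (forall (x : subvs_of R) f, tens_act g f (tens2 (vsval x)) = (beta x : K) *: f) ->
    (forall y, normal_form y -> (forall f, tens_act g f y = 0) -> y = 0) ->
  is_PBW_deformation beta.
Proof.
move=> g_rel g_faithful; have [fun_nat surj_nat] := natural_map_surj beta.
split; [exact: fun_nat | | exact: surj_nat].
move=> a b _ _; rewrite -(repr_qproj a) -(repr_qproj b).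
move: (repr a) (repr b) => {a b}x y Exy; apply/qprojP.
have hz n : hcomp n (x - y) \in ideal_gen (quad_rel R).
  have [t [t1 t2 /qprojP t3]] := quad_normal_form (@homogeneous_hcomp n (x - y)).
  suff t0 : t = 0 by apply/qproj_eq0; rewrite t3 t0; apply/qproj_eq0; rewrite rpred0.
  have := natural_mapE beta (hcomp n (x - y)) n.
  rewrite t3 natural_mapE (hcomp_id t1) (hcomp_id (@homogeneous_hcomp n _)).
  have := congr1 (fun h => h n) Exy; rewrite !natural_mapE => /qprojP.
  rewrite -qprojB -[hcomp n x - _](linearB (@hcomp K d n)) => /qproj_eq0 -> /qproj_eq0.
  case/asboolP => z zn Ez; have [s [s1 s2 s3]] := qc_normal_form zn.
  have ts : t = s.
    apply/eqP; rewrite -subr_eq0; apply/eqP; apply: g_faithful.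
      rewrite addrC -scaleN1r; exact: normal_formP.
    move=> f; apply: (@tens_act_ideal _ _ _ _ (qc_rel beta)).
      move=> _ h [r ->]; rewrite raddfB /= g_rel linearZ /= tens_act1.
      by rewrite subrr.
    by apply/qprojP; rewrite -s3.
  apply/malgP => w; rewrite mcoeff0.
  have [wn|/t1 //] := eqVneq (fdeg w) n.
  by rewrite ts; apply: ((tsizeP s n).1 s1); rewrite wn.
have -> : x - y = \sum_(n < Defs.tsize (x - y)) hcomp n (x - y).
  apply/malgP => w; rewrite raddf_sum /=.
  have [wn|nw] := ltnP (fdeg w) (Defs.tsize (x - y)).
    rewrite (bigD1 (Ordinal wn) isT). rewrite big1.
      by rewrite Monoid.mulm1 hcompE eqxx.
    move=> i /negPf iw; rewrite hcompE eq_sym.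
    by move: iw; rewrite -val_eqE => ->.
  rewrite ((tsizeP _ _).1 (leqnn _) _ nw) big1 => [|i _]; [by []|rewrite hcompE].
  by have /gtn_eqF -> := leq_trans (ltn_ord i) nw.
by apply: rpred_sum => n _; apply: hz.
Qed.

End PBW.

Lemma mcoeff_tgen_sum (K : fieldType) (d : nat) (c : 'I_d -> K) i :
  (\sum_j c j *: tgen K j)@_(fmu i) = c i.
Proof.
have E j : (c j *: tgen K j)@_(fmu i) = c j *+ (j == i).
  rewrite mcoeffZ mcoeffU1 mulr_natr; congr (_ *+ nat_of_bool _).
  by rewrite fmP !fmU; apply/eqP/eqP => [[]|->].
transitivity (\sum_j c j *+ (j == i)).
  by rewrite raddf_sum; apply: eq_bigr => j _; apply: E.
by rewrite (bigD1 i) //= eqxx big1 ?addr0 // => j /negPf ->.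
Qed.

(** A linear combination of generators that vanishes in the deformed algebra is sent to 0 by the
    natural map, hence lies in the quadratic ideal, which has no component of degree 1. *)
Lemma pbw_tgen_free (K : fieldType) (d : nat) (R : {vspace 'M[K]_d})
    (beta : 'Hom(subvs_of R, K^o)) (c : 'I_d -> K) :
  is_PBW_deformation beta ->
  qproj (ideal_gen (qc_rel beta)) (\sum_i c i *: tgen K i) = 0 -> forall i, c i = 0.
Proof.
case=> _ inj_nat _ Ec i; pose x : {malg K[{fmonom 'I_d}]} := \sum_i c i *: tgen K i.
have x1 w : fdeg w != 1%N -> x@_w = 0.
  move=> w1; rewrite raddf_sum big1 // => j _; rewrite /= mcoeffZ mcoeffU.
  by case: (_ =P w) w1 => [<-|]; rewrite ?fdegU ?mulr0.
have : qproj (ideal_gen (quad_rel R)) x = qproj (ideal_gen (quad_rel R)) 0.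
  apply: (inj_nat _ _ (mem_set I) (mem_set I)).
  apply: functional_extensionality_dep => n; rewrite !natural_mapE.
  have [->|n1] := eqVneq n 1%N; last by rewrite (hcomp_neq x1) 1?eq_sym // !linear0.
  by rewrite (hcomp_id x1) linear0 Ec !linear0.
move/qprojP; rewrite subr0 => xR.
have : hcomp 1 x = 0.
  apply: (@hcomp_ideal_ind _ _ _ 2 1 _ (fun t => t = 0)) xR => //.
  - by move=> y z -> ->; rewrite addr0.
  - by move=> t [M ->]; apply: hcomp_tens2.
  by move=> a u t b v _; rewrite addnAC addn2.
by rewrite (hcomp_id x1) => /(congr1 (mcoeff (fmu i))); rewrite mcoeff0 mcoeff_tgen_sum.
Qed.

(** * Overlaps of the quantum Clifford relations *)

Section QuantumCliffordRelations.
Variables (K : fieldType) (A : pzRingType) (io : K -> A).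
Hypothesis ioB : forall c e, io (c - e) = io c - io e.
Hypothesis ioM : forall c e, io (c * e) = io c * io e.
Hypothesis io1 : io 1 = 1.
Hypothesis io_central : forall c x, io c * x = x * io c.

Variables (N : nat) (q mu p : K) (v w : 'I_N -> A) (a b m : 'I_N -> 'I_N -> K).

Definition wv_sum i := \sum_(k < N | (k < i)%N) v k * w k.

Hypothesis q0 : q != 0.
Hypothesis vv_lt : forall i j : 'I_N, (j < i)%N -> v i * v j = io (a i j) - io q * (v j * v i).
Hypothesis vv_eq : forall i, v i * v i = io (a i i).
Hypothesis wv_ne : forall i j, i != j -> w i * v j = io (m i j) - io mu * (v j * w i).
Hypothesis wv_eq : forall i, w i * v i =
  io (m i i) - io (mu / q) * (v i * w i) + io (mu * p) * wv_sum i.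

Lemma io0 : io 0 = 0.
Proof. by rewrite -[X in io X](subrr 0) ioB subrr. Qed.

Lemma io_left c x y : x * (io c * y) = io c * (x * y).
Proof. by rewrite mulrA -io_central mulrA. Qed.

(** Both bracketings of w_i v_j v_j are computed: the square of v_j is a scalar, and moving w_i past
    the two factors costs mu^2. *)
Lemma wvv_ne i j : i != j ->
  io (m i j * (1 - mu)) * v j = io (a j j * (1 - mu ^+ 2)) * w i.
Proof.
move=> ij; have : w i * v j * v j = w i * (v j * v j) by rewrite mulrA.
rewrite vv_eq -io_central (wv_ne ij) mulrBl -!mulrA (wv_ne ij) mulrBr.
rewrite io_left -io_central [v j * (v j * _)]mulrA vv_eq mulrBr => E.
rewrite !mulrBr !mulr1 !ioB !mulrBl -E expr2 opprB addrA.
rewrite [m i j * mu]mulrC [a j j * _]mulrC !ioM -!mulrA.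
by rewrite [RHS]addrAC addrK.
Qed.

(** Both bracketings of w_i v_i v_i are computed. The cubic sum [z] occurs twice, once from each
    side on which the tail [wv_sum i] meets v_i. Its coefficients mu^2 p and - mu^2 p cancel, and a
    linear identity remains. *)
Lemma wvv_eq i :
  io (m i i * (1 - mu / q)) * v i +
    \sum_(k < N | (k < i)%N) io (mu * p * m k i) * v k =
  io (a i i * (1 - (mu / q) ^+ 2)) * w i +
    \sum_(k < N | (k < i)%N) io (mu * p * (mu / q) * a i k) * w k.
Proof.
pose z := \sum_(k < N | (k < i)%N) v k * (v i * w k).
have sum_v : wv_sum i * v i = \sum_(k < N | (k < i)%N) io (m k i) * v k - io mu * z.
  rewrite /wv_sum mulr_suml mulr_sumr -sumrB; apply: eq_bigr => k ki.
  have {}ki : k != i by rewrite -val_eqE /= ltn_eqF.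
  by rewrite -mulrA (wv_ne ki) mulrBr -io_central io_left.
have v_sum : v i * wv_sum i = \sum_(k < N | (k < i)%N) io (a i k) * w k - io q * z.
  rewrite /wv_sum !mulr_sumr -sumrB; apply: eq_bigr => k ki.
  by rewrite mulrA vv_lt // mulrBl -!mulrA.
have E : w i * v i * v i = w i * (v i * v i) by rewrite mulrA.
rewrite vv_eq -io_central wv_eq mulrDl mulrBl -!mulrA wv_eq mulrDr mulrBr in E.
rewrite !io_left sum_v v_sum -io_central [v i * (v i * _)]mulrA vv_eq in E.
have -> : \sum_(k < N | (k < i)%N) io (mu * p * m k i) * v k =
    io (mu * p) * \sum_(k < N | (k < i)%N) io (m k i) * v k.
  by rewrite mulr_sumr; apply: eq_bigr => k _; rewrite ioM mulrA.
have -> : \sum_(k < N | (k < i)%N) io (mu * p * (mu / q) * a i k) * w k =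
    io (mu / q) * (io (mu * p) * \sum_(k < N | (k < i)%N) io (a i k) * w k).
  rewrite !mulr_sumr; apply: eq_bigr => k _.
  by rewrite [_ * (mu / q)]mulrC !ioM !mulrA.
move: (\sum_(k < N | _) _) (\sum_(k < N | _) _) => s t in E *.
rewrite !mulrBr !mulr1 !ioB !mulrBl expr2.
rewrite -[X in _ = X - _ + _]E.
have -> : io (mu * p) * (s - io mu * z) = io (mu * p) * s -
    io (mu / q) * (io (mu * p) * (io q * z)).
  by rewrite mulrBr !mulrA -!ioM; congr (_ - io _ * z); field.
rewrite [m i i * _]mulrC [a i i * _]mulrC !ioM -!mulrA !(mulrDr, mulrN).
have abel (U : zmodType) (e x y r h l : U) :
    e - x + l = e - (x - y + (r - h)) + (l - h) - y + r.
  rewrite opprD !opprB !addrA (ACl (1*3*6*(2*8)*(4*7)*(9*5)))%AC /=.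
  by rewrite !subrr !addr0.
exact: abel.
Qed.

Hypothesis indep : forall c e : 'I_N -> K,
  \sum_i io (c i) * v i = \sum_i io (e i) * w i -> forall i, c i = 0 /\ e i = 0.

Lemma io_sum (u : 'I_N -> A) (i : 'I_N) x (y : 'I_N -> K) :
  io x * u i + \sum_(k < N | (k < i)%N) io (y k) * u k =
  \sum_k io (if k == i then x else if (k < i)%N then y k else 0) * u k.
Proof.
rewrite [RHS](bigD1 i) //= eqxx; congr (_ + _).
rewrite big_mkcond [RHS]big_mkcond; apply: eq_bigr => k _ /=.
case: (eqVneq k i) => [->|ki]; first by rewrite ltnn.
  by case: ifP => //; rewrite io0 mul0r.
Qed.

Lemma io_single (u : 'I_N -> A) i x : io x * u i = \sum_k io (x *+ (k == i)) * u k.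
Proof.
rewrite (bigD1 i) //= eqxx big1 ?addr0 // => k /negPf ->.
by rewrite io0 mul0r.
Qed.

Hypothesis mu0 : mu != 0.
Hypothesis p0 : p != 0.
Hypothesis q2 : q ^+ 2 != 1.
Hypothesis N2 : (2 <= N)%N.

Lemma wvv_constants (i : 'I_N) : [/\ forall j : 'I_N, (j <= i)%N -> a i j = 0,
  m i i * (1 - mu / q) = 0 & forall k : 'I_N, (k < i)%N -> m k i = 0].
Proof.
have := wvv_eq i; rewrite !io_sum => /indep E.
have Elt (k : 'I_N) : (k < i)%N -> a i k = 0 /\ m k i = 0.
  move=> ki; have := E k; rewrite -val_eqE ltn_eqF //= ki.
  case=> /eqP; rewrite !mulf_eq0 (negPf mu0) (negPf p0) /= => /eqP -> /eqP.
  by rewrite !mulf_eq0 invr_eq0 (negPf mu0) (negPf p0) (negPf q0) /= => /eqP.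
have [] := E i; rewrite eqxx => Em Ea.
split=> // [j|k /Elt[] //]; rewrite leq_eqVlt => /orP[/eqP/val_inj ->|/Elt[] //].
(* A second index exists because N >= 2. The word w_k v_i v_i gives a_ii (1 - mu^2) = 0, so a_ii <>
   0 would force mu^2 = 1 and mu^2 = q^2 together. *)
have [k ki] : exists k : 'I_N, k != i.
  exists (if i == Ordinal (ltnW N2) then Ordinal N2 else Ordinal (ltnW N2)).
  by case: (eqVneq i) => [->|]; rewrite // eq_sym.
have := wvv_ne ki; rewrite !io_single => /indep E'.
have [_] := E' k; rewrite eqxx mulr1n => Ea1.
apply/eqP; apply: contraNT q2 => aii; apply/eqP.
have mu2 : mu ^+ 2 = 1 by apply/esym/eqP; rewrite -subr_eq0 -(mulrI_eq0 _ (mulfI aii)) Ea1.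
move/eqP: Ea; rewrite mulf_eq0 (negPf aii) subr_eq0 expr_div_n mu2 div1r => /eqP Eq.
by rewrite -[q ^+ 2]invrK -Eq invr1.
Qed.

Hypothesis a0 : forall i j : 'I_N, (j <= i)%N -> a i j = 0.
Hypothesis mu_q : mu = q.

(* Subtracting consecutive relations makes the sums telescope. *)
Lemma wvv_succ (i j : 'I_N) : p = q - q^-1 -> i = j.+1 :> nat ->
    m i j = 0 -> m j i = 0 ->
  io ((q ^+ 2 - 1) * (m i i - m j j)) * v j = 0.
Proof.
move=> p_def ij mij mji.
have ji : (j < i)%N by rewrite ij.
have mq1 : mu / q = 1 by rewrite mu_q divff.
have sum_i : wv_sum i = wv_sum j + v j * w j.
  rewrite /wv_sum (bigD1 j) //= addrC; congr (_ + _); apply: eq_bigl => k.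
  by rewrite ij ltnS ltn_neqAle andbC.
have vij : v i * v j = - (io q * (v j * v i)) by rewrite vv_lt // a0 ?(ltnW ji) // io0 sub0r.
have wij : w i * v j = - (io q * (v j * w i)).
  by rewrite wv_ne -?val_eqE ?gtn_eqF //= mij io0 sub0r mu_q.
(* The coefficient of v_j w_j is mu/q + mu p = 1 + (q^2 - 1). *)
have wvi : w i * v i = io (m i i - m j j) - v i * w i + w j * v j
    + io (q ^+ 2) * (v j * w j).
  have qp : q * p = q ^+ 2 - 1 by rewrite p_def mulrBr divff // expr2.
  rewrite wv_eq (wv_eq j) mq1 mu_q sum_i mulrDr {2}qp !ioB mulrBl.
  have abel (U : zmodType) (x y e r h l : U) :
      x - e + (r + (h - l)) = x - y - e + (y - l + r) + h.
    by rewrite !addrA (ACl (1*3*6*7*5*(4*2)))%AC /= subrr addr0.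
  by rewrite io1 !mul1r; apply: abel.
have vv0 : v j * v j = 0 by rewrite vv_eq a0 // io0.
have qq x : io q * (io q * x) = io (q ^+ 2) * x by rewrite mulrA -ioM expr2.
(* The two bracketings turn out to have the same cubic terms. The linear term (m_ii - m_jj) v_j
   gains a factor q^2 in the second one only, where v_j has been moved left past both v_i and
   w_i. *)
have El : w i * v i * v j = io (m i i - m j j) * v j -
    io (q ^+ 2) * (v j * (v i * w i)) + io (q ^+ 2) * (v j * (w j * v j)).
  rewrite wvi !mulrDl mulNr -!mulrA vv0 mulr0 addr0 wij mulrN io_left.
  by rewrite [v i * (v j * _)]mulrA vij mulNr mulrN opprK -!mulrA qq.
have Er : w i * (v i * v j) = io (q ^+ 2) * (io (m i i - m j j) * v j -
    v j * (v i * w i) + v j * (w j * v j)).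
  rewrite vij mulrN io_left [w i * _]mulrA wij mulNr mulrN opprK -!mulrA qq wvi.
  rewrite !mulrDr !mulrN io_left [v j * (v j * w j)]mulrA vv0 mul0r !mulr0 addr0.
  by rewrite -io_central.
have E : w i * v i * v j = w i * (v i * v j) by rewrite mulrA.
rewrite El Er !mulrDr mulrN in E; have {}E := addIr _ (addIr _ E).
by rewrite ioM -mulrA ioB io1 mulrBl mul1r -E subrr.
Qed.

Lemma wvv_diag (i j : 'I_N) : p = q - q^-1 ->
    (forall i j, i != j -> m i j = 0) -> m i i = m j j.
Proof.
move=> p_def m0.
have succ (k l : 'I_N) : k = l.+1 :> nat -> m k k = m l l.
  move=> kl; have kl' : k != l by rewrite -val_eqE /= kl gtn_eqF.
  have := wvv_succ p_def kl (m0 _ _ kl') (m0 l k _); rewrite eq_sym => /(_ kl').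
  move=> E; have /indep/(_ l)[] :
      \sum_h io (((q ^+ 2 - 1) * (m k k - m l l)) *+ (h == l)) * v h = \sum_h io 0 * w h.
    by rewrite -io_single E big1 // => h _; rewrite io0 mul0r.
  rewrite eqxx mulr1n => /eqP; rewrite mulf_eq0 subr_eq0 (negPf q2) /=.
  by rewrite subr_eq0 => /eqP.
pose o := Ordinal (ltnW N2).
suff base k : m k k = m o o by rewrite !base.
case: k; elim=> [|n IHn] nN; first by congr (m _ _); apply: val_inj.
by rewrite -(IHn (ltnW nN)); apply: succ.
Qed.

End QuantumCliffordRelations.

(** Scalars enter through a central map [io] into a bare ring, so that the preceding lemmas also
    apply to the opposite ring. The ring itself yields m_ij = 0 for i < j, its opposite yields it
    for i > j. *)
Lemma quantum_clifford_constants (K : fieldType) (A : pzRingType) (io : K -> A)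
    (N : nat) (q mu : K) (v w : 'I_N -> A) (a b m : 'I_N -> 'I_N -> K) :
    (forall c e, io (c - e) = io c - io e) ->
    (forall c e, io (c * e) = io c * io e) -> io 1 = 1 ->
    (forall c x, io c * x = x * io c) ->
    q != 0 -> q ^+ 2 != 1 -> mu != 0 -> (2 <= N)%N ->
    (forall i j : 'I_N, (j < i)%N -> v i * v j = io (a i j) - io q * (v j * v i)) ->
    (forall i, v i * v i = io (a i i)) ->
    (forall i j : 'I_N, (i < j)%N -> w i * w j = io (b i j) - io q * (w j * w i)) ->
    (forall i, w i * w i = io (b i i)) ->
    (forall i j, i != j -> w i * v j = io (m i j) - io mu * (v j * w i)) ->
    (forall i, w i * v i = io (m i i) - io (mu / q) * (v i * w i) +
      io (mu * (q - q^-1)) * \sum_(k < N | (k < i)%N) v k * w k) ->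
    (forall c e : 'I_N -> K,
      \sum_i io (c i) * v i = \sum_i io (e i) * w i -> forall i, c i = 0 /\ e i = 0) ->
  [/\ forall i j : 'I_N, (j <= i)%N -> a i j = 0,
      forall i j : 'I_N, (i <= j)%N -> b i j = 0,
      forall i j : 'I_N, i != j -> m i j = 0,
      mu != q -> forall i, m i i = 0 &
      mu = q -> forall i j, m i i = m j j].
Proof.
move=> ioB ioM io1 ioC q0 q2 mu0 N2 vv_lt vv_eq ww_lt ww_eq wv_ne wv_eq indep.
have p0 : q - q^-1 != 0.
  by apply: contra q2 => /eqP p0; rewrite expr2 -{1}(subrK q^-1 q) p0 add0r mulVf.
have vC := wvv_constants ioB ioM ioC q0 vv_lt vv_eq wv_ne wv_eq indep mu0 p0 q2 N2.
(* In the opposite ring, w and v exchange their roles. *)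
have wC (i : 'I_N) : [/\ forall j : 'I_N, (j <= i)%N -> b j i = 0,
    m i i * (1 - mu / q) = 0 & forall k : 'I_N, (k < i)%N -> m i k = 0].
  apply: (@wvv_constants K A^c io ioB _ _ N q mu (q - q^-1) w v (fun i j => b j i)
    (fun i j => m j i) q0 _ _ _ _ _ mu0 p0 q2 N2 i).
  - by move=> c e; rewrite mulrC; apply: ioM.
  - by move=> c x; apply/esym/ioC.
  - by move=> k j jk; have := ww_lt _ _ jk; rewrite ioC; apply.
  - by move=> k; apply: ww_eq.
  - by move=> k j kj; rewrite eq_sym in kj; have := wv_ne _ _ kj; rewrite ioC; apply.
  - by move=> k; have := wv_eq k; rewrite !ioC; apply.
  move=> c e E k; suff /indep /(_ k)[] :
      \sum_i io (e i) * v i = \sum_i io (c i) * w i by [].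
  by rewrite (eq_bigr _ (fun i _ => ioC (e i) (v i))) -E; apply: eq_bigr.
have m0 (i j : 'I_N) : i != j -> m i j = 0.
  rewrite -val_eqE neq_ltn => /orP[ij|ji]; first by have [_ _] := vC j; apply.
  by have [_ _] := wC i; apply.
split=> //.
- by move=> i j ji; have [+ _ _] := vC i; apply.
- by move=> i j ij; have [+ _ _] := wC j; apply.
- move=> mq i; have [_ /eqP + _] := vC i; rewrite mulf_eq0 subr_eq0.
  rewrite [1 == _]eq_sym => /orP[/eqP //|/eqP E].
  by move: mq; rewrite -[mu](divfK q0) E mul1r eqxx.
move=> mq i j.
apply: (wvv_diag ioB ioM io1 ioC q0 vv_lt vv_eq wv_ne wv_eq indep q2 N2 _ mq) => //.
by move=> k l lk; have [+ _ _] := vC k; apply.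
Qed.

(** * The braidings on basis tensors *)

Section Braiding.
Variables (R : realType) (N : nat) (q : R) (lam : R[i]).
Hypotheses (q_gt0 : 0 < q) (lam0 : lam != 0).

Local Notation C := R[i].
Local Notation qC := (q%:C : C).
Local Notation mu := (lam * qpow q N%:R^-1).
Local Notation one_sigma := (\1 + sigma N q lam)%VF.
Local Notation vi := (lshift N).
Local Notation wi := (@rshift N N).
Local Notation D a b := (delta_mx a b : 'M[C]_(N + N)).

Lemma qC_neq0 : qC != 0.
Proof. by rewrite (inj_eq (@complexI R) q 0) gt_eqF. Qed.

Lemma qpowD s t : qpow q (s + t) = qpow q s * qpow q t.
Proof.
rewrite /qpow powRD; first exact: rmorphM.
by rewrite (gt_eqF q_gt0) implybT.
Qed.

Lemma qpow1 : qpow q 1 = qC.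
Proof. by rewrite /qpow powRr1 // ltW. Qed.

Lemma qpow0 : qpow q 0 = 1.
Proof. by rewrite /qpow powRr0. Qed.

Lemma qpowN1 : qpow q (- 1) = qC^-1.
Proof.
by apply: (mulfI qC_neq0); rewrite -qpow1 -qpowD subrr qpow0 qpow1 divff ?qC_neq0.
Qed.

Lemma qpow_neq0 s : qpow q s != 0.
Proof. by rewrite (inj_eq (@complexI R) _ 0) gt_eqF // powR_gt0. Qed.

Lemma qdiffE : qdiff q = qC - qC^-1.
Proof. by rewrite /qdiff rmorphB fmorphV. Qed.

Definition tensor_map (f : 'I_N -> 'I_N -> 'M[C]_N) (M : 'M[C]_N) : 'M[C]_N :=
  \sum_(i < N) \sum_(j < N) M i j *: f i j.

Lemma tensor_map_is_linear f : linear (tensor_map f).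
Proof.
move=> c M P; rewrite /tensor_map scaler_sumr -big_split; apply: eq_bigr => i _ /=.
rewrite scaler_sumr -big_split; apply: eq_bigr => j _ /=.
by rewrite !mxE scalerDl scalerA.
Qed.
HB.instance Definition _ f := GRing.isLinear.Build C 'M[C]_N 'M[C]_N *:%R
  (tensor_map f) (tensor_map_is_linear f).

Lemma tensor_extE (f : 'I_N -> 'I_N -> 'M[C]_N) M :
  tensor_ext f M = \sum_(i < N) \sum_(j < N) M i j *: f i j.
Proof. exact: (lfunE (tensor_map f)). Qed.

Lemma tensor_ext_delta (f : 'I_N -> 'I_N -> 'M[C]_N) i j :
  tensor_ext f (delta_mx i j) = f i j.
Proof.
rewrite tensor_extE (bigD1 i) //= [X in _ + X]big1 ?addr0; last first.
  by move=> k /negPf ki; rewrite big1 // => l _; rewrite mxE ki scale0r.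
rewrite (bigD1 j) //= [X in _ + X]big1 ?addr0; last first.
  by move=> l /negPf lj; rewrite mxE lj andbF scale0r.
by rewrite mxE !eqxx scale1r.
Qed.

Lemma sigma_fun_is_linear : linear (sigma_fun q lam : 'M[C]_(N + N) -> _).
Proof.
move=> c x y; rewrite /sigma_fun scale_block_mx add_block_mx.
have -> : ulsubmx (c *: x + y) = c *: ulsubmx x + ulsubmx y by apply/matrixP => i j; rewrite !mxE.
have -> : ursubmx (c *: x + y) = c *: ursubmx x + ursubmx y by apply/matrixP => i j; rewrite !mxE.
have -> : dlsubmx (c *: x + y) = c *: dlsubmx x + dlsubmx y by apply/matrixP => i j; rewrite !mxE.
have -> : drsubmx (c *: x + y) = c *: drsubmx x + drsubmx y by apply/matrixP => i j; rewrite !mxE.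
have lin k (f : 'End('M[C]_N)) u v : k *: f (c *: u + v) = c *: (k *: f u) + k *: f v.
  by rewrite (linearP f) scalerDr !scalerA [c * k]mulrC.
by rewrite !lin.
Qed.
HB.instance Definition _ := GRing.isLinear.Build C 'M[C]_(N + N) 'M[C]_(N + N)
  *:%R (sigma_fun q lam) sigma_fun_is_linear.

Lemma one_sigmaE (A B E F : 'M[C]_N) : one_sigma (block_mx A B E F) =
  block_mx (A + qpow q (1 + N%:R^-1) *: R_VV N q A)
           (B + lam *: R_WV N q E)
           (E + lam^-1 *: (R_WV N q)^-1%VF B)
           (F + qpow q (1 + N%:R^-1) *: R_WW N q F).
Proof.
rewrite add_lfunE id_lfunE /sigma (lfunE (sigma_fun q lam)) /=.
by rewrite /sigma_fun !(block_mxKul, block_mxKdl, block_mxKur, block_mxKdr) add_block_mx.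
Qed.

Lemma delta_ul i j : D (vi i) (vi j) = block_mx (delta_mx i j) 0 0 0.
Proof. by rewrite delta_mx_ushift delta_mx_lshift block_mxEv row_mx0. Qed.

Lemma delta_ur i j : D (vi i) (wi j) = block_mx 0 (delta_mx i j) 0 0.
Proof. by rewrite delta_mx_ushift delta_mx_rshift block_mxEv row_mx0. Qed.

Lemma delta_dl i j : D (wi i) (vi j) = block_mx 0 0 (delta_mx i j) 0.
Proof. by rewrite delta_mx_dshift delta_mx_lshift block_mxEv row_mx0. Qed.

Lemma delta_dr i j : D (wi i) (wi j) = block_mx 0 0 0 (delta_mx i j).
Proof. by rewrite delta_mx_dshift delta_mx_rshift block_mxEv row_mx0. Qed.

Definition block_lin := (scale_block_mx, add_block_mx, scaler0, addr0, add0r).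

(** The normalisation q^(1+1/N) in [sigma] absorbs the fractional powers of q in the braidings of V
    and of its dual. *)
Lemma coefR (s : R) : qpow q (1 + N%:R^-1) * qpow q (s - N%:R^-1) = qC * qpow q s.
Proof. by rewrite -qpowD addrACA subrr addr0 qpowD qpow1. Qed.

Lemma coefR1 : qpow q (1 + N%:R^-1) * (qpow q (- N%:R^-1) * qdiff q) = qC ^+ 2 - 1.
Proof.
have := coefR 0; rewrite sub0r qpow0 mulr1 mulrA => ->.
by rewrite qdiffE mulrBr divff ?qC_neq0 // expr2.
Qed.

Lemma one_sigma_VV i j : one_sigma (D (vi i) (vi j)) =
  (1 + (i < j)%N%:R * (qC ^+ 2 - 1)) *: D (vi i) (vi j) +
  (if i == j then qC ^+ 2 else qC) *: D (vi j) (vi i).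
Proof.
rewrite !delta_ul one_sigmaE !linear0 !block_lin; congr block_mx.
rewrite /R_VV tensor_ext_delta scalerDr !scalerA coefR scalerDl scale1r -addrA; congr (_ + _).
rewrite addrC; congr (_ *: _ + _ *: _).
  by case: eqP; rewrite ?qpow1 ?qpow0 ?mulr1.
by rewrite -mulrA mulrCA coefR1.
Qed.

Lemma one_sigma_WW i j : one_sigma (D (wi i) (wi j)) =
  (1 + (j < i)%N%:R * (qC ^+ 2 - 1)) *: D (wi i) (wi j) +
  (if i == j then qC ^+ 2 else qC) *: D (wi j) (wi i).
Proof.
rewrite !delta_dr one_sigmaE !linear0 !block_lin; congr block_mx.
rewrite /R_WW tensor_ext_delta scalerDr !scalerA coefR scalerDl scale1r -addrA; congr (_ + _).
rewrite addrC; congr (_ *: _ + _ *: _).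
  by case: eqP; rewrite ?qpow1 ?qpow0 ?mulr1.
by rewrite -mulrA mulrCA coefR1.
Qed.

Lemma one_sigma_WV_ne i j : i != j ->
  one_sigma (D (wi i) (vi j)) = D (wi i) (vi j) + mu *: D (vi j) (wi i).
Proof.
move=> /negPf ij; rewrite delta_dl delta_ur one_sigmaE !linear0 !block_lin.
congr block_mx; rewrite /R_WV tensor_ext_delta ij subr0 !mul0r scale0r subr0.
by rewrite scalerA.
Qed.

Lemma one_sigma_WV_eq i :
  one_sigma (D (wi i) (vi i)) = D (wi i) (vi i) + (mu / qC) *: D (vi i) (wi i) -
    (mu * (qC - qC^-1)) *: \sum_(k < N | (k < i)%N) D (vi k) (wi k).
Proof.
have -> : \sum_(k < N | (k < i)%N) D (vi k) (wi k) =
    block_mx 0 (\sum_(k < N | (k < i)%N) delta_mx k k) 0 0.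
  rewrite (eq_bigr _ (fun k _ => delta_ur k k)).
  by elim/big_rec2: _ => [|k x y _ ->]; rewrite ?block_mx0 ?block_lin.
rewrite delta_dl delta_ur one_sigmaE !linear0 -scaleNr !block_lin.
congr block_mx; rewrite /R_WV tensor_ext_delta eqxx mul1r.
rewrite scalerDr scalerN !scalerA qpowD qpowN1 mulrA scaleNr; congr (_ - _ *: _).
by rewrite mulrA qdiffE.
Qed.

(** Off the diagonal the braiding permutes basis tensors up to a nonzero factor; on the diagonal it
    is triangular, whence the induction on the index. Surjectivity ensures that the inverse used in
    [sigma] is a genuine right inverse. *)
Lemma R_WV_surjective X : X \in limg (R_WV N q).
Proof.
have off i j : i != j -> delta_mx j i \in limg (R_WV N q).
  move=> /negPf ij; have -> : delta_mx j i = (qpow q N%:R^-1)^-1 *: R_WV N q (delta_mx i j).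
    rewrite tensor_ext_delta ij subr0 !mul0r scale0r subr0.
    by rewrite scalerA mulVf ?qpow_neq0 // scale1r.
  by rewrite memvZ // memv_img ?memvf.
have diag n (i : 'I_N) : (i < n)%N -> delta_mx i i \in limg (R_WV N q).
  elim: n i => // n IHn i; rewrite ltnS => ni.
  have -> : delta_mx i i = (qpow q (N%:R^-1 - 1))^-1 *: (R_WV N q (delta_mx i i) +
      (qpow q N%:R^-1 * qdiff q) *: \sum_(k < N | (k < i)%N) delta_mx k k).
    rewrite tensor_ext_delta eqxx mul1r subrK.
    by rewrite scalerA mulVf ?qpow_neq0 // scale1r.
  rewrite memvZ // memvD ?memv_img ?memvf // memvZ // memv_suml // => k ki.
  by apply: IHn; apply: leq_trans ki ni.
rewrite [X]matrix_sum_delta memv_suml // => j _; rewrite memv_suml // => i _.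
by rewrite memvZ //; case: (eqVneq i j) => [->|/off //]; apply: (diag N).
Qed.

(** On the mixed part [sigma] exchanges the two summands, and its two blocks are inverse to each
    other. Hence id + [sigma] takes the same value at a tensor and at its image under [sigma]. *)
Lemma one_sigma_VW (X : 'M[C]_N) : exists Y : 'M[C]_N,
  one_sigma (block_mx 0 X 0 0) = one_sigma (block_mx 0 0 Y 0).
Proof.
exists (lam^-1 *: (R_WV N q)^-1%VF X); rewrite !one_sigmaE !linear0 !block_lin.
congr block_mx; rewrite linearZ scalerA mulfV // scale1r.
exact: esym (limg_lfunVK (R_WV_surjective X)).
Qed.

(** On the span of v_i v_j and v_j v_i the map [sigma] has eigenvalues q^2 and -1, so id + [sigma]
    has rank one there. *)
Lemma one_sigma_VV_lt (i j : 'I_N) : (i < j)%N ->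
  one_sigma (D (vi i) (vi j)) = qC *: one_sigma (D (vi j) (vi i)).
Proof.
move=> ij; have ne : (i == j) = false by rewrite -val_eqE ltn_eqF.
rewrite !one_sigma_VV ij ltnNge (ltnW ij) mul0r mul1r addr0 subrKC.
rewrite [j == i]eq_sym ne scale1r addrC scalerDr scalerA.
by rewrite expr2.
Qed.

Lemma one_sigma_WW_gt (i j : 'I_N) : (j < i)%N ->
  one_sigma (D (wi i) (wi j)) = qC *: one_sigma (D (wi j) (wi i)).
Proof.
move=> ij; have ne : (i == j) = false by rewrite -val_eqE gtn_eqF.
rewrite !one_sigma_WW ij ltnNge (ltnW ij) mul0r mul1r addr0 subrKC.
rewrite [j == i]eq_sym ne scale1r addrC scalerDr scalerA.
by rewrite expr2.
Qed.

(** The three listed families span [R_H]. This serves both to show that [beta] is determined by its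
    values on them and to verify the deformed relations on the Fock space. *)
Lemma one_sigma_ind (U : lmodType C) (phi : 'M[C]_(N + N) -> U) : linear phi ->
    (forall i j : 'I_N, (j <= i)%N -> phi (one_sigma (D (vi i) (vi j))) = 0) ->
    (forall i j : 'I_N, (i <= j)%N -> phi (one_sigma (D (wi i) (wi j))) = 0) ->
    (forall i j : 'I_N, phi (one_sigma (D (wi i) (vi j))) = 0) ->
  forall X, phi (one_sigma X) = 0.
Proof.
move=> phi_lin phiV phiW phiM X.
pose L : {linear 'M[C]_(N + N) -> U} :=
  HB.pack phi (GRing.isLinear.Build _ _ _ _ phi phi_lin).
rewrite -[phi]/(L : _ -> _) in phiV phiW phiM *; move: L phiV phiW phiM => {phi_lin}phi phiV phiW phiM.
have phiZ c Z : phi (one_sigma Z) = 0 -> phi (one_sigma (c *: Z)) = 0.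
  by move=> Z0; rewrite !linearZ /= Z0 scaler0.
have phiDL (Y : 'M[C]_N) : phi (one_sigma (block_mx 0 0 Y 0)) = 0.
  have -> : block_mx 0 0 Y 0 = \sum_i \sum_j Y i j *: D (wi i) (vi j).
    rewrite {1}[Y]matrix_sum_delta; apply: esym.
    under eq_bigr => i _ do under eq_bigr => j _ do rewrite delta_dl !block_lin.
    under eq_bigr => i _.
      rewrite (_ : \sum_j _ = block_mx 0 0 (\sum_j Y i j *: delta_mx i j) 0); last first.
        by elim/big_rec2: _ => [|j x y _ ->]; rewrite ?block_mx0 ?block_lin.
      over.
    by elim/big_rec2: _ => [|j x y _ ->]; rewrite ?block_mx0 ?block_lin.
  rewrite !linear_sum big1 // => i _; rewrite !linear_sum big1 // => j _.
  exact/phiZ/phiM.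
rewrite [X]matrix_sum_delta !linear_sum big1 // => a _.
rewrite !linear_sum big1 // => b _; apply: phiZ.
case: (split_ordP a) => i ->; case: (split_ordP b) => j ->.
- have [/phiV //|ij] := leqP j i.
  by rewrite one_sigma_VV_lt // linearZ /= phiV ?scaler0 // ltnW.
- by rewrite delta_ur; have [Y ->] := one_sigma_VW (delta_mx i j); apply: phiDL.
- exact: phiM.
have [/phiW //|ij] := leqP i j.
by rewrite one_sigma_WW_gt // linearZ /= phiW ?scaler0 // ltnW.
Qed.

End Braiding.

(** * The quantum Fock space *)

Section FockSpace.
Variables (K : fieldType) (N : nat) (q c : K).

Local Notation fock := {ffun {set 'I_N} -> K^o}.
Implicit Types (f : fock) (S B : {set 'I_N}).

Let regE (a : K) (x : K^o) : a *: x = a * x := erefl.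

(** The factor produced when v_n moves right past the v_k with k in [S] and k < n, each exchange
    costing -q. The bound is a natural number so that one can induct on it. *)
Definition fock_sgn (n : nat) S : K := (- q) ^+ #|[set k in S | (k < n)%N]|.

(* The value f S is the coefficient of the ordered product of the v_i, i in S. *)
Definition fock_create (i : 'I_N) f : fock :=
  [ffun S : {set 'I_N} => if i \in S then fock_sgn i S * f (S :\ i) else 0].

Definition fock_annih (i : 'I_N) f : fock :=
  [ffun S : {set 'I_N} => if i \in S then 0 else c * fock_sgn i S * f (i |: S)].

Lemma fock_create_is_linear i : linear (fock_create i).
Proof.
move=> a f h; apply/ffunP => S; rewrite !ffunE !regE.
by case: ifP => _; rewrite ?mulr0 ?addr0 // mulrDr mulrCA.
Qed.
HB.instance Definition _ i := GRing.isLinear.Build K fock fock *:%R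
  (fock_create i) (fock_create_is_linear i).

Lemma fock_annih_is_linear i : linear (fock_annih i).
Proof.
move=> a f h; apply/ffunP => S; rewrite !ffunE !regE.
by case: ifP => _; rewrite ?mulr0 ?addr0 // mulrDr mulrCA.
Qed.
HB.instance Definition _ i := GRing.isLinear.Build K fock fock *:%R
  (fock_annih i) (fock_annih_is_linear i).

Lemma fock_sgnU1 n (j : 'I_N) S : j \notin S ->
  fock_sgn n (j |: S) = (if (j < n)%N then - q else 1) * fock_sgn n S.
Proof.
move=> jS; rewrite /fock_sgn; case: ifP => jn.
  rewrite -exprS; congr (_ ^+ _).
  rewrite (_ : [set k in j |: S | _] = j |: [set k in S | (k < n)%N]).
    by rewrite cardsU1 inE (negPf jS).
  by apply/finset.setP => k; rewrite !inE; case: eqP => // ->; rewrite jn.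
rewrite mul1r; congr (_ ^+ _); apply: eq_card => k.
by rewrite !inE; case: eqP => // ->; rewrite jn !andbF.
Qed.

Lemma fock_sgnD1 n (j : 'I_N) S : j \in S ->
  fock_sgn n S = (if (j < n)%N then - q else 1) * fock_sgn n (S :\ j).
Proof. by move=> jS; rewrite -{1}(finset.setD1K jS) fock_sgnU1 // finset.setD11. Qed.

Lemma fock_create2 i f : fock_create i (fock_create i f) = 0.
Proof. by apply/ffunP => S; rewrite !ffunE finset.setD11 mulr0 if_same. Qed.

Lemma fock_annih2 i f : fock_annih i (fock_annih i f) = 0.
Proof. by apply/ffunP => S; rewrite !ffunE finset.setU11 mulr0 if_same. Qed.

Lemma fock_create_create (i j : 'I_N) f : (j < i)%N ->
  fock_create i (fock_create j f) = - q *: fock_create j (fock_create i f).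
Proof.
move=> ji; apply/ffunP => S; rewrite !ffunE !inE ?regE ?regE.
have ij : (i == j) = false by rewrite -val_eqE gtn_eqF.
rewrite ij [j == i]eq_sym ij /=.
case: (boolP (i \in S)) => iS; last by case: ifP; rewrite !mulr0.
case: (boolP (j \in S)) => jS; last by rewrite !mulr0.
rewrite (fock_sgnD1 i jS) ji [fock_sgn j S](fock_sgnD1 _ iS) ltnNge (ltnW ji) mul1r.
by rewrite finset.setDDl finset.setUC -finset.setDDl; ring.
Qed.

Lemma fock_annih_annih (i j : 'I_N) f : (i < j)%N ->
  fock_annih i (fock_annih j f) = - q *: fock_annih j (fock_annih i f).
Proof.
move=> ij; apply/ffunP => S; rewrite !ffunE !inE ?regE ?regE.
have ji : (i == j) = false by rewrite -val_eqE ltn_eqF.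
rewrite ji [j == i]eq_sym ji /=.
case: (boolP (i \in S)) => iS; first by case: ifP; rewrite !mulr0.
case: (boolP (j \in S)) => jS; first by rewrite !mulr0.
rewrite (fock_sgnU1 j iS) ij (fock_sgnU1 i jS) ltnNge (ltnW ij) mul1r.
by rewrite finset.setUCA; ring.
Qed.

Lemma fock_annih_create (i j : 'I_N) f : i != j ->
  fock_annih i (fock_create j f) = - q *: fock_create j (fock_annih i f).
Proof.
move=> ij; apply/ffunP => S; rewrite !ffunE !inE ?regE ?regE.
rewrite [j == i]eq_sym (negPf ij) /=.
case: (boolP (i \in S)) => iS; first by case: ifP; rewrite !mulr0.
case: (boolP (j \in S)) => jS; last by rewrite !mulr0.
have -> : (i |: S) :\ j = i |: (S :\ j).
  by apply/finset.setP => k; rewrite !inE; case: (eqVneq k i) => [->|]; rewrite ?ij.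
rewrite (fock_sgnU1 j iS) (fock_sgnD1 i jS).
by move: ij; rewrite -val_eqE neq_ltn => /orP[] lt; rewrite lt ltnNge (ltnW lt) /=; ring.
Qed.

(** Passing k in [S] multiplies the squared factor by q^2, so each summand, multiplied by q^2 - 1,
    is the increment at k; the starting value is 1. *)
Lemma fock_sgn_telescope n S : (n <= N)%N ->
  1 + (q ^+ 2 - 1) * (\sum_(k < N | (k < n)%N) if k \in S then fock_sgn k S ^+ 2 else 0) =
  fock_sgn n S ^+ 2.
Proof.
elim: n => [_|n IHn nN].
  rewrite big_pred0 // mulr0 addr0 /fock_sgn.
  rewrite (_ : [set k in S | _] = finset.set0) ?cards0 ?expr1n //.
  by apply/finset.setP => k; rewrite !inE andbF.
pose o := Ordinal nN; have {}IHn := IHn (ltnW nN).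
rewrite (bigD1 o) //= (eq_bigl (fun k : 'I_N => (k < n)%N)); last first.
  by move=> k; rewrite -val_eqE /= ltnS andbC ltn_neqAle.
have lt_succ (k : 'I_N) : (k < n.+1)%N = (k == o) || (k < n)%N.
  by rewrite -val_eqE /= ltnS leq_eqVlt.
case: (boolP (o \in S)) => oS.
  rewrite mulrDr addrCA IHn (fock_sgnD1 n.+1 oS) /= ltnSn.
  rewrite (_ : fock_sgn n.+1 (S :\ o) = fock_sgn n S); first by ring.
  congr (_ ^+ _); apply: eq_card => k; rewrite !inE lt_succ.
  by case: eqP => [->|] //=; rewrite ltnn andbF.
rewrite add0r IHn; congr (_ ^+ _ ^+ _); apply: eq_card => k.
by rewrite !inE lt_succ; case: eqP => [->|] //=; rewrite (negPf oS).
Qed.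

(** This is the relation M_ii for mu = q. Every term is diagonal in the basis of subsets. At [S]
    exactly one of the first two terms is active, according to whether i lies in [S], and both give
    the same factor c [fock_sgn i S]^2; the sum then telescopes down to c. *)
Lemma fock_annih_create_diag (i : 'I_N) f :
  fock_annih i (fock_create i f) + fock_create i (fock_annih i f) -
    (q ^+ 2 - 1) *: (\sum_(k < N | (k < i)%N) fock_create k (fock_annih k f)) = c *: f.
Proof.
apply/ffunP => S.
have cr_an k : fock_create k (fock_annih k f) S =
    (if k \in S then fock_sgn k S ^+ 2 else 0) * (c * f S).
  rewrite !ffunE; case: ifP => kS; last by rewrite mul0r.
  by rewrite finset.setD11 finset.setD1K // {1}(fock_sgnD1 k kS) ltnn (fock_sgnD1 k kS) ltnn; ring.
have diag : (fock_annih i (fock_create i f) + fock_create i (fock_annih i f)) S =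
    fock_sgn i S ^+ 2 * (c * f S).
  rewrite [LHS]ffunE cr_an !ffunE; case: ifP => iS; first by rewrite add0r.
  by rewrite finset.setU11 finset.setU1K ?iS // fock_sgnU1 ?iS // ltnn; ring.
rewrite [LHS]ffunE diag [X in _ + X]ffunE [X in - X]ffunE [RHS]ffunE !regE sum_ffunE.
rewrite -(fock_sgn_telescope S (ltnW (ltn_ord i))).
by rewrite (eq_bigr _ (fun k _ => cr_an k)) -mulr_suml; ring.
Qed.

(** * Matrix coefficients of normal words *)

Definition fock_gen (a : 'I_(N + N)) : {linear fock -> fock} :=
  match fintype.split a with
  | inl i => fock_create i : {linear fock -> fock}
  | inr i => fock_annih i : {linear fock -> fock}
  end.

Lemma fock_genl i : fock_gen (lshift N i) =1 fock_create i.
Proof.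
move=> f; rewrite /fock_gen; case: split_ordP => j /eqP; rewrite ?eq_shift //.
by move=> /eqP ->.
Qed.

Lemma fock_genr i : fock_gen (rshift N i) =1 fock_annih i.
Proof.
move=> f; rewrite /fock_gen; case: split_ordP => j /eqP; rewrite ?eq_shift //.
by move=> /eqP ->.
Qed.

Definition creators (u : seq 'I_(N + N)) := [set i : 'I_N | lshift N i \in u].
Definition annihilators (u : seq 'I_(N + N)) := [set i : 'I_N | rshift N i \in u].

Definition fock_basis B : fock := [ffun S : {set 'I_N} => (S == B)%:R].

Hypotheses (q0 : q != 0) (c0 : c != 0).

Lemma fock_sgn_neq0 n S : fock_sgn n S != 0.
Proof. by rewrite expf_neq0 // oppr_eq0. Qed.

(** In a normal word the annihilators stand on the right and act first: they remove their indices
    from [B], then the creators add theirs. Each letter sends a basis vector to a multiple of a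
    basis vector, with a nonzero factor as long as the index can be added or removed. *)
Lemma word_act_fock_basis (u : seq 'I_(N + N)) B S : normal_word u ->
  (word_act fock_gen u (fock_basis B) S != 0) =
  [&& creators u \subset S, [disjoint annihilators u & S :\: creators u]
    & B == (S :\: creators u) :|: annihilators u].
Proof.
elim: u S => [|a u IHu] S u_nf.
  have -> : creators [::] = finset.set0 by apply/finset.setP => i; rewrite !inE.
  have -> : annihilators [::] = finset.set0 by apply/finset.setP => i; rewrite !inE.
  rewrite finset.sub0set finset.setD0 finset.setU0 finset.disjoints_subset finset.sub0set.
  by rewrite /= ffunE [S == B]eq_sym; case: (B == S); rewrite ?eqxx ?oner_eq0.
have {}IHu := IHu _ (path_sorted u_nf).
have a_lt : all (fun b : 'I_(N + N) => (a < b)%N) u.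
  by apply: order_path_min u_nf => x y z; apply: ltn_trans.
have au : a \notin u by apply/negP => /(allP a_lt); rewrite ltnn.
rewrite [word_act _ _ _]/=; move: au a_lt {u_nf}.
case: (split_ordP a) => i -> iu a_lt.
  rewrite fock_genl ffunE.
  have -> : creators (lshift N i :: u) = i |: creators u.
    by apply/finset.setP => k; rewrite !inE eq_lshift.
  have -> : annihilators (lshift N i :: u) = annihilators u.
    by apply/finset.setP => k; rewrite !inE eq_rlshift.
  rewrite finset.subUset finset.sub1set -finset.setDDl.
  case: (boolP (i \in S)) => iS; last by rewrite eqxx.
  rewrite mulf_eq0 (negPf (fock_sgn_neq0 _ _)) /= IHu; congr (_ && _).
  by rewrite finset.subsetD1 inE iu andbT.
rewrite fock_genr ffunE.
have cr0 : creators u = finset.set0.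
  apply/finset.setP => k; rewrite !inE; apply/negP => /(allP a_lt) /=.
  by rewrite ltnNge ltnW // (leq_trans (ltn_ord k)) // leq_addr.
have -> : creators (rshift N i :: u) = finset.set0.
  by apply/finset.setP => k; rewrite !inE eq_lrshift /=; move/finset.setP/(_ k): cr0; rewrite !inE.
have -> : annihilators (rshift N i :: u) = i |: annihilators u.
  by apply/finset.setP => k; rewrite !inE eq_rshift.
rewrite !finset.sub0set !finset.setD0 /=.
have iA : i \notin annihilators u by rewrite inE.
case: (boolP (i \in S)) => iS.
  rewrite eqxx; apply/esym/negbTE; rewrite negb_and; apply/orP; left.
  by apply/pred0Pn; exists i; rewrite /= !inE eqxx iS.
rewrite !mulf_eq0 (negPf c0) (negPf (fock_sgn_neq0 _ _)) /= IHu cr0.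
rewrite finset.sub0set finset.setD0 /= finset.setUCA finset.setUA; congr (_ && _).
have disjU1 (A A' : {set 'I_N}) : i \notin A' -> [disjoint i |: A & A'] = [disjoint A & A'].
  by move=> iA'; rewrite !finset.disjoints_subset finset.subUset finset.sub1set finset.in_setC iA'.
by rewrite disjoint_sym !disjU1 // disjoint_sym.
Qed.

Lemma normal_word_inj (u w : seq 'I_(N + N)) : normal_word u -> normal_word w ->
  creators u = creators w -> annihilators u = annihilators w -> u = w.
Proof.
move=> u_nf w_nf Ec Ea; apply: (irr_sorted_eq _ _ u_nf w_nf).
- by move=> x y z; apply: ltn_trans.
- by move=> x; apply: ltnn.
move=> a; case: (split_ordP a) => i ->.
  by move/finset.setP/(_ i): Ec; rewrite !inE.
by move/finset.setP/(_ i): Ea; rewrite !inE.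
Qed.

(** The coefficients of [y] are shown to vanish by induction on the number of annihilators in the
    word. *)
Lemma fock_faithful (y : {malg K[{fmonom 'I_(N + N)}]}) : normal_form y ->
  (forall f, tens_act fock_gen f y = 0) -> y = 0.
Proof.
move=> y_nf y_act; apply/malgP => w; rewrite mcoeff0.
have [n] := ubnP #|annihilators w|; elim: n w => // n IHn w; rewrite ltnS => wn.
have [w_nf|/y_nf //] := boolP (normal_word w).
case: (msuppP y w) => // wy.
(* The word [w] empties [B] and then builds [S]. Another normal word [u] that contributes at the
   same place has its annihilators in [B]. If there are fewer of them, the induction hypothesis
   kills its coefficient. If they fill [B], nothing outside the creators of [u] is left in [S], so
   [u] equals [w]. *)
pose B := annihilators w; pose S := creators w.
have := congr1 (fun f : fock => f S) (y_act (fock_basis B)).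
rewrite /tens_act sum_ffunE [RHS]ffunE (big_fsetD1 w) //= big1_fset => [|u].
  rewrite addr0 ffunE regE => /eqP; rewrite mulf_eq0 => /orP[/eqP //|].
  apply: contraTeq => _; rewrite word_act_fock_basis // finset.setDv finset.set0U.
  by rewrite eqxx subxx finset.disjoints_subset finset.setC0 finset.subsetT.
rewrite !inE => /andP[uw _] _; rewrite ffunE regE; apply/eqP; rewrite mulf_eq0.
have [u_nf|/y_nf ->] := boolP (normal_word u); last by rewrite eqxx.
apply/norP => -[yu]; rewrite word_act_fock_basis // => /and3P[uS uBS /eqP BE].
have uB : annihilators u \subset B by rewrite BE finset.subsetUr.
have [Bu|uB_lt] := leqP #|B| #|annihilators u|; last first.
  by move: yu; rewrite IHn ?eqxx // (leq_trans uB_lt).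
have Ea : annihilators u = B by apply/eqP; rewrite eqEcard uB.
case/eqP: uw; apply/eqP; rewrite fmP; apply/eqP/normal_word_inj => //.
apply/eqP; rewrite finset.eqEsubset uS /=.
apply/fintype.subsetP => i iS; apply: contraT => iu.
have iD : i \in S :\: creators u by rewrite finset.in_setD iu.
have iB : i \in annihilators u by rewrite Ea BE finset.in_setU iD.
by have := disjointFr uBS iB; rewrite iD.
Qed.

End FockSpace.

(** * Deformations of the twisted quantum exterior algebra *)

Lemma split_combination (K : pzRingType) (V : lmodType K) (N : nat)
    (f : 'I_(N + N) -> V) (c e : 'I_N -> K) : exists x : 'I_(N + N) -> K,
  [/\ forall k, x (lshift N k) = c k, forall k, x (rshift N k) = - e k &
      \sum_a x a *: f a =
        \sum_k c k *: f (lshift N k) - \sum_k e k *: f (rshift N k)].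
Proof.
pose x a := match fintype.split a with inl i => c i | inr i => - e i end.
have xl k : x (lshift N k) = c k.
  by rewrite /x; case: split_ordP => j /eqP; rewrite ?eq_shift // => /eqP ->.
have xr k : x (rshift N k) = - e k.
  by rewrite /x; case: split_ordP => j /eqP; rewrite ?eq_shift // => /eqP ->.
exists x; split=> //; rewrite big_split_ord -sumrN.
by congr (_ + _); apply: eq_bigr => k _; rewrite (xl, xr) ?scaleNr.
Qed.

Section Deformations.
Variables (R : realType) (N : nat) (q : R) (lam : R[i]).
Hypotheses (N2 : (2 <= N)%N) (q_gt0 : 0 < q) (q_neq1 : q != 1) (lam0 : lam != 0).

Local Notation C := R[i].
Local Notation qC := (q%:C : C).
Local Notation mu := (lam * qpow q N%:R^-1).
Local Notation one_sigma := (\1 + sigma N q lam)%VF.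
Local Notation vi := (lshift N).
Local Notation wi := (@rshift N N).
Local Notation D a b := (delta_mx a b : 'M[C]_(N + N)).
Local Notation RH := (R_H N q lam).
Local Notation v i := (tgen C (vi i)).
Local Notation w i := (tgen C (wi i)).
Implicit Types (beta : 'Hom(subvs_of RH, C^o)) (X : 'M[C]_(N + N)).

Lemma one_sigma_RH X : one_sigma X \in RH.
Proof. by rewrite memv_img ?memvf. Qed.

Lemma val_relation_of X : vsval (relation_of q lam X) = one_sigma X.
Proof. by rewrite vsprojK ?one_sigma_RH. Qed.

Lemma relation_ofP (x : subvs_of RH) : exists X, x = relation_of q lam X.
Proof.
have /memv_imgP[X _ EX] := subvsP x.
by exists X; apply: val_inj; rewrite [RHS]val_relation_of.
Qed.

Lemma relVE (i j : 'I_N) : relV q lam i j = relation_of q lam (D (vi i) (vi j)).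
Proof. by rewrite delta_ul. Qed.

Lemma relWE (i j : 'I_N) : relW q lam i j = relation_of q lam (D (wi i) (wi j)).
Proof. by rewrite delta_dr. Qed.

Lemma relME (i j : 'I_N) : relM q lam i j = relation_of q lam (D (wi i) (vi j)).
Proof. by rewrite delta_dl. Qed.

Lemma qC2_neq1 : qC ^+ 2 != 1.
Proof.
rewrite -[qC ^+ 2]rmorphXn -[1](rmorph1 (real_complex R)) (inj_eq (@complexI R)).
by rewrite sqrp_eq1 // ltW.
Qed.

Lemma qC2D1_neq0 : 1 + qC ^+ 2 != 0.
Proof.
rewrite -[qC ^+ 2]rmorphXn -[1](rmorph1 (real_complex R)) -rmorphD.
by rewrite (inj_eq (@complexI R) _ 0) gt_eqF // ltr_wpDr ?sqr_ge0 // ltr01.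
Qed.

Lemma mu_neq0 : mu != 0.
Proof. by rewrite mulf_neq0 ?qpow_neq0. Qed.

Lemma mu_eq_qC : (mu == qC) = (lam == (q `^ (1 - N%:R^-1))%:C).
Proof.
rewrite -(inj_eq (mulIf (qpow_neq0 q_gt0 N%:R^-1)) lam) -/(qpow q _) -qpowD //.
by rewrite subrK qpow1.
Qed.

Lemma one_sigma_VV_gt (i j : 'I_N) : (j < i)%N ->
  one_sigma (D (vi i) (vi j)) = D (vi i) (vi j) + qC *: D (vi j) (vi i).
Proof.
move=> ji; have ij : (i == j) = false by rewrite -val_eqE gtn_eqF.
by rewrite one_sigma_VV // ltnNge (ltnW ji) mul0r addr0 scale1r ij.
Qed.

Lemma one_sigma_VV_eq (i : 'I_N) :
  one_sigma (D (vi i) (vi i)) = (1 + qC ^+ 2) *: D (vi i) (vi i).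
Proof. by rewrite one_sigma_VV // ltnn mul0r addr0 eqxx -scalerDl. Qed.

Lemma one_sigma_WW_lt (i j : 'I_N) : (i < j)%N ->
  one_sigma (D (wi i) (wi j)) = D (wi i) (wi j) + qC *: D (wi j) (wi i).
Proof.
move=> ij; have ji : (i == j) = false by rewrite -val_eqE ltn_eqF.
by rewrite one_sigma_WW // ltnNge (ltnW ij) mul0r addr0 scale1r ji.
Qed.

Lemma one_sigma_WW_eq (i : 'I_N) :
  one_sigma (D (wi i) (wi i)) = (1 + qC ^+ 2) *: D (wi i) (wi i).
Proof. by rewrite one_sigma_WW // ltnn mul0r addr0 eqxx -scalerDl. Qed.

Lemma tens2_VV_gt (i j : 'I_N) : (j < i)%N ->
  tens2 (one_sigma (D (vi i) (vi j))) = v i * v j + qC *: (v j * v i).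
Proof. by move=> ji; rewrite one_sigma_VV_gt // tens2D tens2Z !tens2_delta. Qed.

Lemma tens2_VV_eq (i : 'I_N) :
  tens2 (one_sigma (D (vi i) (vi i))) = (1 + qC ^+ 2) *: (v i * v i).
Proof. by rewrite one_sigma_VV_eq tens2Z tens2_delta. Qed.

Lemma tens2_WW_lt (i j : 'I_N) : (i < j)%N ->
  tens2 (one_sigma (D (wi i) (wi j))) = w i * w j + qC *: (w j * w i).
Proof. by move=> ij; rewrite one_sigma_WW_lt // tens2D tens2Z !tens2_delta. Qed.

Lemma tens2_WW_eq (i : 'I_N) :
  tens2 (one_sigma (D (wi i) (wi i))) = (1 + qC ^+ 2) *: (w i * w i).
Proof. by rewrite one_sigma_WW_eq tens2Z tens2_delta. Qed.

Lemma tens2_WV_ne (i j : 'I_N) : i != j ->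
  tens2 (one_sigma (D (wi i) (vi j))) = w i * v j + mu *: (v j * w i).
Proof. by move=> ij; rewrite one_sigma_WV_ne // tens2D tens2Z !tens2_delta. Qed.

Lemma tens2_WV_eq (i : 'I_N) : tens2 (one_sigma (D (wi i) (vi i))) =
  w i * v i + (mu / qC) *: (v i * w i) -
    (mu * (qC - qC^-1)) *: \sum_(k < N | (k < i)%N) v k * w k.
Proof.
rewrite one_sigma_WV_eq // tens2B tens2D !tens2Z !tens2_delta; congr (_ - _ *: _).
by rewrite [LHS]linear_sum; apply: eq_bigr => k _; apply: tens2_delta.
Qed.

Lemma clifford_values_zero beta : clifford_values beta 0 -> beta = 0.
Proof.
case=> bV bW bM; apply/lfunP => x; rewrite zero_lfunE.
have [X ->] := relation_ofP x.
pose phi X := beta (vsproj RH X) : C.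
apply: (@one_sigma_ind R N q lam q_gt0 lam0 C^o phi).
- by move=> c Y Z; rewrite /phi !linearP.
- by move=> i j ji; have := bV i j ji; rewrite relVE.
- by move=> i j ji; have := bW i j ji; rewrite relWE.
- by move=> i j; have := bM i j; rewrite relME mulr0.
Qed.

Lemma clifford_values_inj beta beta' c :
  clifford_values beta c -> clifford_values beta' c -> beta = beta'.
Proof.
move=> [bV bW bM] [bV' bW' bM']; apply/eqP; rewrite -subr_eq0; apply/eqP.
apply: clifford_values_zero; split=> i j.
- by move=> ij; rewrite add_lfunE opp_lfunE bV ?bV' ?subrr.
- by move=> ij; rewrite add_lfunE opp_lfunE bW ?bW' ?subrr.
by rewrite add_lfunE opp_lfunE bM bM' subrr mulr0.
Qed.

(** The trace of the component with w on the left and v on the right. This component is 0 for V_ij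
    and W_ij and is the basis tensor (i, j) for M_ij, so the form takes the required values. *)
Definition clifford_form (c : C) (x : subvs_of RH) : C^o := c * \tr (dlsubmx (vsval x)).

Lemma clifford_form_is_linear c : linear (clifford_form c).
Proof.
move=> a x y; rewrite /clifford_form linearP /=.
have -> : dlsubmx (a *: vsval x + vsval y) = a *: dlsubmx (vsval x) + dlsubmx (vsval y).
  by apply/matrixP => i j; rewrite !mxE.
by rewrite mxtraceD mxtraceZ mulrDr mulrCA.
Qed.
HB.instance Definition _ c := GRing.isLinear.Build C (subvs_of RH) C^o *:%R
  (clifford_form c) (clifford_form_is_linear c).

Lemma clifford_formP c : clifford_values (linfun (clifford_form c)) c.
Proof.
have E X : linfun (clifford_form c) (relation_of q lam X) = c * \tr (dlsubmx (one_sigma X)).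
  by rewrite lfunE; congr (_ * \tr (dlsubmx _)); apply: val_relation_of.
split=> i j.
- by rewrite /relV E one_sigmaE block_mxKdl !linear0 addr0 linear0 mulr0.
- by rewrite /relW E one_sigmaE block_mxKdl !linear0 addr0 linear0 mulr0.
rewrite /relM E one_sigmaE.
rewrite block_mxKdl !linear0 addr0 mulrC; congr (_ * c).
rewrite /mxtrace (bigD1 i) //= mxE eqxx big1 ?addr0 => [|k /negPf ki].
  by [].
by rewrite mxE ki.
Qed.

(** With all v before all w, each non-increasing pair leads a multiple of one relation V_ij, W_ij or
    M_ij. In M_ii the whole tail starts with some v, hence with a smaller letter. *)
Lemma RH_leading (a b : 'I_(N + N)) : (b <= a)%N ->
  exists2 M, D a b + M \in RH & forall c e, M c e != 0 -> (c < a)%N.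
Proof.
have deltaP k (x y c e : 'I_(N + N)) : (k *: D x y) c e != 0 -> c = x.
  by rewrite !mxE; case: (c =P x) => //; rewrite mulr0 eqxx.
have zeroP (x c e : 'I_(N + N)) : (0 : 'M[C]_(N + N)) c e != 0 -> (c < x)%N.
  by rewrite mxE eqxx.
have diag (x : 'I_(N + N)) :
    one_sigma (D x x) = (1 + qC ^+ 2) *: D x x -> D x x + 0 \in RH.
  move=> Ex; rewrite addr0 -[D x x](scalerK qC2D1_neq0) -Ex.
  by rewrite rpredZ // one_sigma_RH.
case: (split_ordP a) => i ->; case: (split_ordP b) => j ->.
- rewrite leq_eqVlt => /orP[/eqP ij|ji].
    have -> : j = i by apply: val_inj.
    exists 0; last by move=> c e; apply: zeroP.
    exact/diag/one_sigma_VV_eq.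
  exists (qC *: D (vi j) (vi i)); last by move=> c e /deltaP ->.
  by rewrite -one_sigma_VV_gt // one_sigma_RH.
- by rewrite /= leqNgt (leq_trans (ltn_ord i)) // leq_addr.
- move=> _; have [->|ij] := eqVneq i j.
    have := one_sigma_RH (D (wi j) (vi j)); rewrite one_sigma_WV_eq // -addrA => H.
    eexists; first exact: H.
    move=> c e; rewrite mxE => cne0; have [x ->] : exists x, c = vi x; last first.
      by rewrite /= (leq_trans (ltn_ord x)) // leq_addr.
    move: cne0; have [/deltaP -> _|] := boolP (((mu / qC) *: D (vi j) (wi j)) c e != 0).
      by exists j.
    rewrite negbK => /eqP ->; rewrite add0r !mxE oppr_eq0 mulf_eq0 => /norP[_].
    rewrite summxE => cne0; apply: contrapT => nc; move: cne0.
    rewrite big1 ?eqxx // => k _; rewrite mxE; case: eqP => // ck.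
    by case: nc; exists k.
  exists (mu *: D (vi j) (wi i)); last first.
    by move=> c e /deltaP -> /=; rewrite (leq_trans (ltn_ord j)) // leq_addr.
  by rewrite -one_sigma_WV_ne // one_sigma_RH.
rewrite /= leq_add2l leq_eqVlt => /orP[/eqP ij|ji].
  have -> : j = i by apply: val_inj.
  exists 0; last by move=> c e; apply: (zeroP (wi i)).
  exact/diag/one_sigma_WW_eq.
exists (qC^-1 *: D (wi j) (wi i)); last by move=> c e /deltaP -> /=; rewrite ltn_add2l.
(* In W_ji the leading pair w_i w_j has coefficient q, which is divided out. *)
have -> : D (wi i) (wi j) + qC^-1 *: D (wi j) (wi i) =
    qC^-1 *: one_sigma (D (wi j) (wi i)).
  rewrite (one_sigma_WW_lt ji) scalerDr scalerA (mulVf (qC_neq0 q_gt0)) scale1r.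
  exact: addrC.
by rewrite rpredZ // one_sigma_RH.
Qed.

(** The Fock operators satisfy the deformed relations, which suffices to check on the spanning
    families. The condition c <> 0 keeps the annihilators nonzero, as faithfulness on normal forms
    requires. *)
Lemma clifford_pbw beta c : mu = qC -> c != 0 -> clifford_values beta c ->
  is_PBW_deformation beta.
Proof.
move=> mu_q c0 [bV bW bM].
apply: (pbw_of_faithful_action RH_leading (g := fock_gen qC c)); last first.
  exact: (fock_faithful (qC_neq0 q_gt0) c0).
move=> x f; have [X ->] := relation_ofP x; rewrite val_relation_of.
pose g := fock_gen (N := N) qC c.
pose phi X := tens_act g f (tens2 X) - (beta (vsproj RH X) : C) *: f.
suff : phi (one_sigma X) = 0 by move/eqP; rewrite subr_eq0 => /eqP.
have gE (a b : 'I_(N + N)) : tens_act g f (tgen C a * tgen C b) = g a (g b f).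
  by rewrite tens_actM !tens_act_tgen.
apply: (@one_sigma_ind R N q lam q_gt0 lam0).
- move=> a Y Z; rewrite /phi !linearP /=.
  by rewrite scalerBr scalerDl addrACA -opprD scalerA.
- move=> i j ji; rewrite /phi; have := bV i j ji; rewrite relVE => ->.
  rewrite scale0r subr0; move: ji; rewrite leq_eqVlt => /orP[/eqP/val_inj ->|ji].
    by rewrite tens2_VV_eq tens_actZ gE /g !fock_genl fock_create2 scaler0.
  rewrite (tens2_VV_gt ji) tens_actD gE tens_actZ gE /g !fock_genl (fock_create_create _ _ ji).
  by rewrite -scalerDl addNr scale0r.
- move=> i j ij; rewrite /phi; have := bW i j ij; rewrite relWE => ->.
  rewrite scale0r subr0; move: ij; rewrite leq_eqVlt => /orP[/eqP/val_inj ->|ij].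
    by rewrite tens2_WW_eq tens_actZ gE /g !fock_genr fock_annih2 scaler0.
  rewrite (tens2_WW_lt ij) tens_actD gE tens_actZ gE /g !fock_genr (fock_annih_annih _ _ _ ij).
  by rewrite -scalerDl addNr scale0r.
move=> i j; rewrite /phi; have := bM i j; rewrite relME => ->.
have [->|ij] := eqVneq i j; last first.
  rewrite mul0r scale0r subr0 (tens2_WV_ne ij) tens_actD gE tens_actZ gE /g.
  rewrite !fock_genr !fock_genl (fock_annih_create _ _ _ ij) mu_q.
  by rewrite -scalerDl addNr scale0r.
have Es : tens_act g f (\sum_(k < N | (k < j)%N) v k * w k) =
    \sum_(k < N | (k < j)%N) fock_create qC k (fock_annih qC c k f).
  by rewrite tens_act_sum; apply: eq_bigr => k _; rewrite gE /g fock_genl fock_genr.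
have E1 : tens_act g f (w j * v j) = fock_annih qC c j (fock_create qC j f).
  by rewrite gE /g fock_genr fock_genl.
have E2 : tens_act g f (v j * w j) = fock_create qC j (fock_annih qC c j f).
  by rewrite gE /g fock_genr fock_genl.
have comb a e (x1 x2 x3 y1 y2 y3 : {ffun {set 'I_N} -> C^o}) :
    x1 = y1 -> x2 = y2 -> x3 = y3 ->
    x1 + a *: x2 - e *: x3 = y1 + a *: y2 - e *: y3.
  by move=> -> -> ->.
rewrite tens2_WV_eq (etrans (tens_act_lin _ _ _ _ _ _ _) (comb _ _ _ _ _ _ _ _ E1 E2 Es)).
(* For mu = q the two coefficients of M_ii become mu/q = 1 and mu (q - q^-1) = q^2 - 1, those of
   [fock_annih_create_diag]. *)
rewrite mu_q (divff (qC_neq0 q_gt0)) scale1r.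
rewrite mulrBr (divff (qC_neq0 q_gt0)) -expr2.
rewrite fock_annih_create_diag mul1r.
exact: subrr.
Qed.

(** * Constants forced by the PBW property *)

Lemma tgen_indep beta (c e : 'I_N -> C) : is_PBW_deformation beta ->
  let U := ideal_gen (qc_rel beta) in
  qproj U (\sum_i c i *: v i) = qproj U (\sum_i e i *: w i) ->
  forall i, c i = 0 /\ e i = 0.
Proof.
move=> pbw U; have [x [xl xr x_sum]] := split_combination (@tgen C (N + N)) c e.
move=> E i; have x0 : forall a, x a = 0.
  apply: (pbw_tgen_free pbw).
  have Ex : \sum_a x a *: tgen C a = \sum_k c k *: v k - \sum_k e k *: w k.
    exact: x_sum.
  rewrite Ex qprojB.
  exact: etrans (congr1 (fun t => t - _) E) (subrr _).
split; first by rewrite -xl x0.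
by apply: oppr_inj; rewrite -xr x0 oppr0.
Qed.

(** The relations are read inside the deformed algebra, where the generators are independent, and
    [quantum_clifford_constants] is applied to their classes. *)
Lemma pbw_constants beta : is_PBW_deformation beta -> exists c,
  clifford_values beta c /\ (mu != qC -> c = 0).
Proof.
move=> pbw; pose U := ideal_gen (qc_rel beta); pose io (c : C) := qproj U c%:A.
have ioZ c x : io c * qproj U x = qproj U (c *: x).
  by rewrite -qprojM -scalerAl mul1r.
have ioB c e : io (c - e) = io c - io e by rewrite /io scalerBl qprojB.
have ioM c e : io (c * e) = io c * io e by rewrite ioZ scalerA.
have io1 : io 1 = 1 by rewrite /io scale1r qproj1.
have ioC c x : io c * x = x * io c.
  rewrite -(repr_qproj x); move: (repr x) => y.
  by rewrite ioZ /io -qprojM -malgZAr mulr1.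
have rel X : qproj U (tens2 (one_sigma X)) = io (beta (relation_of q lam X)).
  apply/qprojP; apply: mem_ideal_gen; exists (relation_of q lam X).
  by rewrite val_relation_of.
clearbody io; pose bV i j := beta (relation_of q lam (D (vi i) (vi j))) : C.
pose bW i j := beta (relation_of q lam (D (wi i) (wi j))) : C.
pose m i j := beta (relation_of q lam (D (wi i) (vi j))) : C.
(* V_ii and W_ii are 1 + q^2 times a square, so the constants of the squares themselves are the
   values of [beta] divided by 1 + q^2. *)
pose a i j := bV i j / (if i == j then 1 + qC ^+ 2 else 1).
pose b i j := bW i j / (if i == j then 1 + qC ^+ 2 else 1).
have sq_eq x c : qproj U ((1 + qC ^+ 2) *: (x * x)) = io c ->
    qproj U x * qproj U x = io (c / (1 + qC ^+ 2)).
  move=> E; rewrite [c / _]mulrC ioM -E ioZ scalerA (mulVf qC2D1_neq0) scale1r.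
  exact: esym (qprojM _ _ _).
have lt_eq x y c e : qproj U (x * y + c *: (y * x)) = io e ->
    qproj U x * qproj U y = io e - io c * (qproj U y * qproj U x).
  by move=> <-; rewrite -[qproj U y * _]qprojM ioZ qprojD addrK qprojM.
have relE X t e : tens2 (one_sigma X) = t -> beta (relation_of q lam X) = e ->
    qproj U t = io e.
  by move=> <- <-; apply: rel.
have vv_lt (i j : 'I_N) : (j < i)%N -> qproj U (v i) * qproj U (v j) =
    io (a i j) - io qC * (qproj U (v j) * qproj U (v i)).
  move=> ji; apply: (lt_eq (v i) (v j) qC); apply: relE (tens2_VV_gt ji) _.
  by rewrite /a -val_eqE gtn_eqF // divr1.
have vv_eq i : qproj U (v i) * qproj U (v i) = io (a i i).
  by rewrite /a eqxx; apply: sq_eq; apply: relE (tens2_VV_eq i) _.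
have ww_lt (i j : 'I_N) : (i < j)%N -> qproj U (w i) * qproj U (w j) =
    io (b i j) - io qC * (qproj U (w j) * qproj U (w i)).
  move=> ij; apply: (lt_eq (w i) (w j) qC); apply: relE (tens2_WW_lt ij) _.
  by rewrite /b -val_eqE ltn_eqF // divr1.
have ww_eq i : qproj U (w i) * qproj U (w i) = io (b i i).
  by rewrite /b eqxx; apply: sq_eq; apply: relE (tens2_WW_eq i) _.
have wv_ne (i j : 'I_N) : i != j -> qproj U (w i) * qproj U (v j) =
    io (m i j) - io mu * (qproj U (v j) * qproj U (w i)).
  by move=> ij; apply: (lt_eq (w i) (v j) mu); apply: relE (tens2_WV_ne ij) _.
have lin_eq x y z c e h : qproj U (x + c *: y - e *: z) = io h ->
    qproj U x = io h - io c * qproj U y + io e * qproj U z.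
  have move_terms (G : zmodType) (g1 g2 g3 g4 : G) : g1 + g2 - g3 = g4 -> g1 = g4 - g2 + g3.
    by move=> <-; rewrite [_ - g3 - g2]addrAC addrK subrK.
  by move=> E; rewrite (ioZ c y) (ioZ e z); apply: move_terms; rewrite -E qprojB qprojD.
have wv_eq (i : 'I_N) : qproj U (w i) * qproj U (v i) =
    io (m i i) - io (mu / qC) * (qproj U (v i) * qproj U (w i)) +
    io (mu * (qC - qC^-1)) * \sum_(k < N | (k < i)%N) qproj U (v k) * qproj U (w k).
  have E := lin_eq _ _ _ _ _ _ (relE _ _ _ (tens2_WV_eq i) erefl).
  have Es : qproj U (\sum_(k < N | (k < i)%N) v k * w k) =
      \sum_(k < N | (k < i)%N) qproj U (v k) * qproj U (w k).
    by rewrite [LHS]raddf_sum; apply: eq_bigr => k _; apply: qprojM.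
  have comb (G : pzRingType) (c e h y z y' z' : G) : y = y' -> z = z' ->
      h - c * y + e * z = h - c * y' + e * z' by move=> -> ->.
  exact: etrans (esym (qprojM _ _ _)) (etrans E (comb _ _ _ _ _ _ _ _ (qprojM _ _ _) Es)).
have indep (c e : 'I_N -> C) :
    \sum_i io (c i) * qproj U (v i) = \sum_i io (e i) * qproj U (w i) ->
    forall i, c i = 0 /\ e i = 0.
  have sumE h (x : 'I_N -> {malg C[{fmonom 'I_(N + N)}]}) :
      qproj U (\sum_i h i *: x i) = \sum_i io (h i) * qproj U (x i).
    by rewrite [LHS]raddf_sum; apply: eq_bigr => i _; apply: esym; apply: ioZ.
  move=> E; apply: (tgen_indep pbw).
  exact: etrans (sumE c (fun i => v i)) (etrans E (esym (sumE e (fun i => w i)))).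
have [a0 b0 m0 diag0 diag] := quantum_clifford_constants ioB ioM io1 ioC
  (qC_neq0 q_gt0) qC2_neq1 mu_neq0 N2 vv_lt vv_eq ww_lt ww_eq wv_ne wv_eq indep.
have den0 (i j : 'I_N) : (if i == j then 1 + qC ^+ 2 else 1) != 0.
  by case: ifP => _; rewrite ?oner_neq0 ?qC2D1_neq0.
pose o := Ordinal (ltnW N2); exists (m o o); split; last by move=> mq; apply: diag0.
split=> i j.
- move=> ji; rewrite relVE; have /eqP := a0 i j ji.
  by rewrite mulf_eq0 invr_eq0 (negPf (den0 i j)) orbF => /eqP.
- move=> ij; rewrite relWE; have /eqP := b0 i j ij.
  by rewrite mulf_eq0 invr_eq0 (negPf (den0 i j)) orbF => /eqP.
rewrite relME; have [->|ij] := eqVneq i j; last by rewrite mul0r; apply: m0.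
rewrite mul1r; have [mq|mq] := eqVneq mu qC; first exact: diag.
by rewrite (diag0 mq o); apply: diag0.
Qed.

End Deformations.

Theorem theorem7p8 (R : realType) (N : nat) (q : R) (lam : R[i])
    (hN : (2 <= N)%N) (hq : 0 < q) (hq1 : q != 1) (hlam : lam != 0) :
  (lam != (q `^ (1 - N%:R^-1))%:C ->
     forall beta : 'Hom(subvs_of (R_H N q lam), R[i]^o),
       is_PBW_deformation beta -> beta = 0) /\
  (lam = (q `^ (1 - N%:R^-1))%:C ->
     (forall beta : 'Hom(subvs_of (R_H N q lam), R[i]^o), beta != 0 ->
        (is_PBW_deformation beta <->
         exists c : R[i], c != 0 /\ clifford_values beta c)) /\
     (forall c : R[i], c != 0 ->
        exists! beta : 'Hom(subvs_of (R_H N q lam), R[i]^o),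
          clifford_values beta c)).
Proof.
split=> [lam_ne beta pbw|lam_eq].
  have [c [cv c0]] := pbw_constants hN hq hq1 hlam pbw.
  apply: (clifford_values_zero hq hlam).
  by move: cv; rewrite c0 // mu_eq_qC.
have mu_q : lam * qpow q N%:R^-1 = q%:C by apply/eqP; rewrite mu_eq_qC // lam_eq.
split=> [beta beta0|c c0].
  split=> [pbw|[c [c0 cv]]]; last exact: (clifford_pbw hq hlam mu_q c0 cv).
  have [c [cv _]] := pbw_constants hN hq hq1 hlam pbw.
  exists c; split=> //; apply: contraNneq beta0 => c0; rewrite c0 in cv.
  exact/eqP/(clifford_values_zero hq hlam cv).
exists (linfun (clifford_form c)); split; first exact: clifford_formP.
by move=> beta; apply: (clifford_values_inj hq hlam); apply: clifford_formP.
Qed.
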